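(* Let $V\subseteq\mathbb N$ be finite with $|V|\ge2$. The total order $\succ_{\mathrm{fac}}$ on the facets of $\Delta_V$ is a shelling order, with shelling sets $\sigma(F)$ defined recursively by $\sigma(F)=\emptyset$ if $|V|\le 3$; $\sigma(F)=\sigma(F^2)$ if $V(F^1)=\{\min V,\operatorname{min}_2 V\}$; and $\sigma(F)=\sigma(F^2)\cup\{\{\min X,\max X\}:X\in\mathcal L(\mathcal T(F^1))\}$ otherwise. That is: (SH1) if $F\succ_{\mathrm{fac}}G$ then $\sigma(F)\not\subseteq G$; and (SH2) for each $e\in\sigma(F)$ there is a facet $G\prec_{\mathrm{fac}}F$ with $F\setminus G=\{e\}$. In particular $\Delta_V$ is shellable.
   Context: A path $(v_1,\dots,v_k)$ in an edge set is forbidden if $k\ge4$, $v_1=\max(v_1,\dots,v_k)$, $v_k=\max(v_2,\dots,v_k)$, $v_2>v_{k-1}$. $\Delta_V$ is the simplicial complex on $E(K_V)$ whose faces are edge sets containing no forbidden path; it is pure and each facet $F$ has a unique decomposition $F=F^1\sqcup F^2\sqcup\{\{\min V,\max V\}\}$ with $F^i$ a facet of $\Delta_{V(F^i)}$, $V(F^1)\cup V(F^2)=V$, $V(F^1)\cap V(F^2)=\{\max V(F^1)\}$, $\min V\in V(F^1)$, $\max V\in V(F^2)$ ($V(E)$ = vertices incident to $E$). The decomposition tree $\mathcal T(F)$ is the binary tree with root labeled $V$, older subtree $\mathcal T(F^1)$ and younger subtree $\mathcal T(F^2)$ (a single node labeled $V$ if $|V|=2$); its nodes are in bijection with the edges of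 $F$ via $X\mapsto\{\min X,\max X\}$. For a binary tree $T$, $\mathcal L(T)$ is the set of the root and all firstborn nodes (older children); the traversal of $T$ is the preorder list: root, then the traversal of the older subtree, then that of the younger subtree. $\operatorname{min}_2 V$ denotes the second smallest element of $V$. Order finite subsets of $\mathbb N$ by $X\succ Y$ iff $|X|>|Y|$, or $|X|=|Y|$ and $\min(X\triangle Y)\in Y$. For facets $F,G$ of $\Delta_V$ with traversals $(X_1,\dots,X_N)$ of $\mathcal T(F)$ and $(Y_1,\dots,Y_N)$ of $\mathcal T(G)$ ($N=2|V|-3$), let $k$ be the least index with $X_k\neq Y_k$; then $F\succ_{\mathrm{fac}}G$ iff $X_k\succ Y_k$. *)

(* Defs.v *)
(* with Stdlib's ClassicalEpsilon for choosing the
   (unique, by the paper) decomposition F = F^1 ⊔ F^2 ⊔ {{min V, max V}}. *)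
From Stdlib Require Import ClassicalEpsilon.
From mathcomp Require Import all_boot.

Set Implicit Arguments.
Unset Strict Implicit.
Unset Printing Implicit Defensive.

Section DeltaV.
(* Vertices: natural numbers < n.+1 (every finite V ⊆ ℕ lives in some 'I_n.+1);
   the order on vertices is the order of their nat values. *)
Context {n : nat}.
Local Notation T := 'I_n.+1.

Definition mino (A : {set T}) : T := inord (\big[minn/n]_(i in A) (val i)).
Definition maxo (A : {set T}) : T := inord (\max_(i in A) (val i)).
Definition min2o (A : {set T}) : T := mino (A :\ mino A).

Definition edgesK (V : {set T}) : {set {set T}} :=
  [set e : {set T} | (e \subset V) && (#|e| == 2)].

Definition VE (E : {set {set T}}) : {set T} := \bigcup_(e in E) e.

Definition forbidden_path (F : {set {set T}}) (s : seq T) : Prop :=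
  let k := size s in
  let v i := val (nth ord0 s i) in
  [/\ 4 <= k, uniq s &
      (forall i, i.+1 < k -> [set nth ord0 s i; nth ord0 s i.+1] \in F)] /\
  [/\
      (forall i, i < k -> v i <= v 0),
      (forall i, 0 < i < k -> v i <= v k.-1) &
      v k.-2 < v 1].

Definition face (V : {set T}) (F : {set {set T}}) : Prop :=
  F \subset edgesK V /\ ~ (exists s, forbidden_path F s).

Definition facet (V : {set T}) (F : {set {set T}}) : Prop :=
  face V F /\ (forall G, face V G -> F \subset G -> G = F).

Definition is_decomp (V : {set T}) (F F1 F2 : {set {set T}}) : Prop :=
  [/\ facet (VE F1) F1, facet (VE F2) F2,
      VE F1 :|: VE F2 = V & VE F1 :&: VE F2 = [set maxo (VE F1)]] /\
  [/\ mino V \in VE F1, maxo V \in VE F2,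
      F = F1 :|: F2 :|: [set [set mino V; maxo V]],
      [disjoint F1 & F2] &
      [set mino V; maxo V] \notin F1 :|: F2].

Definition decomp (V : {set T}) (F : {set {set T}}) :
    {set {set T}} * {set {set T}} :=
  epsilon (inhabits (set0, set0)) (fun p => is_decomp V F p.1 p.2).

Inductive dtree :=
  | DLeaf of {set T}
  | DNode of {set T} & dtree & dtree.

Definition droot (t : dtree) : {set T} :=
  match t with DLeaf X => X | DNode X _ _ => X end.

Fixpoint traversal (t : dtree) : seq {set T} :=
  match t with
  | DLeaf X => [:: X]
  | DNode X l r => X :: traversal l ++ traversal r
  end.

Fixpoint firstborn (t : dtree) : seq {set T} :=
  match t with
  | DLeaf _ => [::]
  | DNode _ l r => droot l :: firstborn l ++ firstborn r
  end.

Definition Lnodes (t : dtree) : seq {set T} := droot t :: firstborn t.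

Fixpoint dtree_fuel (k : nat) (V : {set T}) (F : {set {set T}}) : dtree :=
  match k with
  | 0 => DLeaf V
  | k'.+1 =>
      if #|V| <= 2 then DLeaf V
      else let p := decomp V F in
           DNode V (dtree_fuel k' (VE p.1) p.1) (dtree_fuel k' (VE p.2) p.2)
  end.

Definition decomp_tree (V : {set T}) (F : {set {set T}}) : dtree :=
  dtree_fuel #|V| V F.

Fixpoint sigma_fuel (k : nat) (V : {set T}) (F : {set {set T}}) : {set {set T}} :=
  match k with
  | 0 => set0
  | k'.+1 =>
      if #|V| <= 3 then set0
      else let p := decomp V F in
           if VE p.1 == [set mino V; min2o V]
           then sigma_fuel k' (VE p.2) p.2
           else sigma_fuel k' (VE p.2) p.2 :|:
                [set [set mino X; maxo X] |
                   X in [pred X | X \in Lnodes (decomp_tree (VE p.1) p.1)]]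
  end.

Definition sigma (V : {set T}) (F : {set {set T}}) : {set {set T}} :=
  sigma_fuel #|V| V F.

Definition setgt (X Y : {set T}) : bool :=
  (#|Y| < #|X|) ||
  [&& #|X| == #|Y|, X != Y & mino ((X :\: Y) :|: (Y :\: X)) \in Y].

Fixpoint lexgt (s t : seq {set T}) : bool :=
  match s, t with
  | x :: s', y :: t' => if x == y then lexgt s' t' else setgt x y
  | _, _ => false
  end.

Definition facgt (V : {set T}) (F G : {set {set T}}) : bool :=
  lexgt (traversal (decomp_tree V F)) (traversal (decomp_tree V G)).

End DeltaV.

(* Main.v *)
(* The existence of a forbidden path depends only on vertices z < y < b < a
   with ay, bz in F and y, z connected in F below b ([forb]), so everything
   is about connectivity.  A face is cut at the largest neighbour x of
   min V other than max V: the older side is what min V reaches below x.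
   Conversely, gluing two facets along such a cut gives a facet, because in a
   facet every vertex but max V reaches min V without meeting max V, and u < b
   reaches a vertex above b through vertices below b; any added edge thus
   creates a forbidden path.

   (SH1): the edges of L(T(F1)) form a spanning tree of V(F1) with max V(F1) as
   a leaf, so a facet G containing them has V(F1) inside V(G1).

   (SH2): removing the edge e of a node either leaves a face that can be cut
   earlier, hence lies in a smaller facet, or disconnects V minus max V; in the
   latter case the face can be cut earlier one level up in the tree. *)
From Stdlib Require Import ClassicalEpsilon.
Require Import Defs.
From mathcomp Require Import all_boot zify.

Set Implicit Arguments.
Unset Strict Implicit.
Unset Printing Implicit Defensive.

(* Letting [lia] compare [mino V] with [maxo V] up to conversion is very slow. *)
Ltac olia :=
  lazymatch goal with |- is_true (_ \in _) => exfalso | _ => idtac end;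
  repeat match goal with H : is_true (leq _ _) |- _ => revert H end;
  repeat match goal with |- context [@nat_of_ord ?m ?i] =>
    generalize (@nat_of_ord m i); intro end;
  clear; lia.

Section Shelling.
Context {n : nat}.
Local Notation T := 'I_n.+1.
Implicit Types (V W A C X Y : {set T}) (F G H : {set {set T}}).
Implicit Types (a b u v w x y z : T).

(** * Smallest and largest elements of vertex sets *)

Lemma big_minn_le A a (r : seq T) :
  a \in r -> a \in A -> \big[minn/n]_(i <- r | i \in A) val i <= a.
Proof.
elim: r => // c r IH; rewrite inE => /predU1P[<-|ar] aA; rewrite big_cons.
  by rewrite aA geq_minl.
by case: ifP => _; [apply: leq_trans (geq_minr _ _) _|]; exact: IH.
Qed.

Lemma mino_spec A a : a \in A -> mino A \in A /\ mino A <= a.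
Proof.
move=> aA; rewrite /mino; set k := \big[_/_]_(_ in _) _.
have le_k c : c \in A -> k <= c by apply: big_minn_le; rewrite mem_index_enum.
have kE : k = n \/ exists2 c, c \in A & k = val c.
  apply: (big_ind (fun k => k = n \/ exists2 c, c \in A & k = val c)); first by left.
    by move=> p q Hp Hq; rewrite /minn; case: ifP.
  by move=> c cA; right; exists c.
have [c cA kc] : exists2 c, c \in A & k = val c.
  (* If the fold only returns its default [n], every element of [A] is at least [n], so [a] itself
     has value [n]. *)
  case: kE => // kn; exists a => //; apply/eqP; rewrite eqn_leq le_k //=.
  by rewrite kn -ltnS ltn_ord.
by rewrite kc inord_val; split=> //; rewrite -[nat_of_ord c]kc le_k.
Qed.

Lemma maxo_spec A a : a \in A -> maxo A \in A /\ a <= maxo A.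
Proof.
move=> aA; rewrite /maxo.
have [c cA kc] := eq_bigmax_cond (fun i : T => val i) (introT card_gt0P (ex_intro _ a aA)).
by rewrite kc inord_val; split=> //; rewrite -[nat_of_ord c]kc (leq_bigmax_cond (F := fun i : T => val i)).
Qed.

Lemma mino_in A a : a \in A -> mino A \in A.
Proof. by case/mino_spec. Qed.

Lemma mino_le A a : a \in A -> mino A <= a.
Proof. by case/mino_spec. Qed.

Lemma maxo_in A a : a \in A -> maxo A \in A.
Proof. by case/maxo_spec. Qed.

Lemma maxo_ge A a : a \in A -> a <= maxo A.
Proof. by case/maxo_spec. Qed.

Lemma mino_eq A a : a \in A -> (forall b, b \in A -> a <= b) -> mino A = a.
Proof.
move=> aA le_a; apply/val_inj/eqP; rewrite eqn_leq.
by rewrite (mino_le aA) (le_a _ (mino_in aA)).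
Qed.

Lemma maxo_eq A a : a \in A -> (forall b, b \in A -> b <= a) -> maxo A = a.
Proof.
move=> aA le_a; apply/val_inj/eqP; rewrite eqn_leq.
by rewrite (maxo_ge aA) (le_a _ (maxo_in aA)).
Qed.

Lemma set2_eqP a b c d :
  [set a; b] = [set c; d] -> (a = c /\ b = d) \/ (a = d /\ b = c).
Proof.
move=> E; have := set21 a b; have := set22 a b; rewrite {1 2}E.
have := set21 c d; have := set22 c d; rewrite -{1 2}E !inE.
by do 4![move=> /orP[/eqP ?|/eqP ?]]; subst; auto.
Qed.

(** * Connectivity through vertices below a bound, and forbidden paths *)

Definition below F (k : nat) : rel T :=
  fun u v => [&& [set u; v] \in F, u < k & v < k].

Lemma below_sym F k : symmetric (below F k).
Proof. by move=> u v; rewrite /below setUC [(u < k) && _]andbC. Qed.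

Definition conn F k := connect (below F k).

Lemma conn_sym F k u v : conn F k u v = conn F k v u.
Proof. exact: (sym_connect_sym (@below_sym F k)). Qed.

Lemma conn_trans F k : transitive (conn F k).
Proof. exact: connect_trans. Qed.

Lemma conn_edge F k u v : [set u; v] \in F -> u < k -> v < k -> conn F k u v.
Proof. by move=> *; apply/connect1/and3P. Qed.

(** Lets later proofs follow a route by an invariant [P] instead of an explicit path. *)
Lemma conn_inv (P : T -> Prop) F k u v :
  conn F k u v -> P u ->
  (forall s t, P s -> [set s; t] \in F -> s < k -> t < k -> P t) -> P v.
Proof.
move=> /connectP[p] + ->; elim: p u => //= w p IH u /andP[/and3P[uw uk wk] Hp] Pu Pstep.
exact: IH Hp (Pstep _ _ Pu uw uk wk) Pstep.
Qed.

Lemma conn_lt F k u v : conn F k u v -> u < k -> v < k.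
Proof. by move=> c uk; apply: (conn_inv (P := fun w => w < k) c). Qed.

Lemma conn_sub F G k l u v :
  conn F k u v -> k <= l ->
  (forall s t : T, s < k -> t < k -> [set s; t] \in F -> [set s; t] \in G) ->
  conn G l u v.
Proof.
move=> c kl sub; apply: (conn_inv (P := conn G l u) c); first exact: connect0.
move=> s t us st sk tk; apply: conn_trans us _.
by apply: conn_edge (leq_trans sk kl) (leq_trans tk kl); apply: sub.
Qed.

Lemma connS F G k l u v : conn F k u v -> k <= l -> F \subset G -> conn G l u v.
Proof. by move=> c kl /subsetP sub; apply: conn_sub c kl _ => s t _ _ /sub. Qed.

(* Erasing the two ends of a forbidden path and forgetting the route in
   between leaves this pattern, with a = v_1, b = v_k, y = v_2, z = v_(k-1). *)
Definition forb F := exists a b y z,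
  [/\ z < y, y < b, b < a, [set a; y] \in F & [set b; z] \in F] /\ conn F b y z.

(** The inner vertices of a forbidden path are at most its last vertex [b] by maximality and differ
    from it by uniqueness, so they form a route below [b]. Conversely, a route below [b] can be
    shortened to a simple one, and it avoids [b] and the larger [a]. *)
Lemma forbP F : (exists s, forbidden_path F s) <-> forb F.
Proof.
have nthp y b (p : seq T) i :
    i < (size p).+1 -> nth ord0 (y :: rcons p b) i = nth ord0 (y :: p) i.
  by move=> ip; rewrite -rcons_cons nth_rcons ip.
split=> [[s [[k4 us es] [max0 maxk lt12]]]|].
- case: s k4 us es max0 maxk lt12 => // a s; case: (lastP s) => // {}s b.
  case: s => // y p; rewrite /= size_rcons /= => k4 us es max0 maxk lt12.
  have lasty : nth ord0 (y :: rcons p b) (size p) = last y p.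
    by rewrite -rcons_cons nth_rcons /= ltnS leqnn -[size p]/(size (y :: p)).-1 nth_last.
  have lastb : nth ord0 (rcons p b) (size p) = b by rewrite nth_rcons ltnn eqxx.
  rewrite lasty in lt12; rewrite lastb in maxk.
  have Hb w : w \in y :: p -> w < b.
    move=> wp.
    have wb : w <= b.
      have: index w (y :: p) < size (y :: p) by rewrite index_mem.
      move: (nth_index ord0 wp); move: (index w _) => i <- /= ip; rewrite -(nthp _ b) //.
      by apply: (maxk i.+1); rewrite !ltnS; lia.
    rewrite ltn_neqAle wb andbT; apply/negP => /eqP/val_inj E.
    have : uniq (a :: rcons (y :: p) b) := us.
    by rewrite cons_uniq rcons_uniq -E wp andbF.
  have ba : b < a.
    (* [(size p).+2] is the index of [b] in the path. *)
    have := max0 (size p).+2; rewrite /= lastb => /(_ ltac:(lia)) ba.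
    rewrite ltn_neqAle ba andbT; apply/negP => /eqP/val_inj E.
    by move: us; rewrite /= E inE mem_rcons inE eqxx orbT.
  exists a, b, y, (last y p); split.
    split=> //; first by apply: Hb; rewrite mem_head.
      exact: (es 0).
    by have := es (size p).+1; rewrite /= lasty lastb setUC; apply.
  apply/connectP; exists p => //; apply/(pathP ord0) => i ip.
  apply/and3P; split; last 2 first.
  + by apply: Hb; rewrite mem_nth //= ltnW.
  + by apply: Hb; rewrite inE mem_nth ?orbT.
  have := es i.+1; rewrite /= nthp 1?nth_rcons ?ip; first by apply; lia.
  by lia.
- case=> a [b [y [z [[zy yb ba ay bz] /connectP cyz]]]].
  have [p [Hp up zE]] : exists p : seq T,
    [/\ path (below F b) y p, uniq (y :: p) & z = last y p].
    by case: cyz => p0 Hp0; case: (shortenP Hp0) => p Hp up _ zE; exists p.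
  have Hb w : w \in y :: p -> w < b.
    rewrite inE => /predU1P[-> //|wp]; move: Hp => /(pathP ord0) /(_ (index w p)).
    by rewrite index_mem wp => /(_ isT) /and3P[_ _]; rewrite nth_index.
  (* [z < y] rules out the empty route; this provides the fourth vertex. *)
  have p0 : 0 < size p by case: p zE {Hp up Hb} => // E; rewrite E ltnn in zy.
  exists (a :: rcons (y :: p) b); split.
    split; first by rewrite /= size_rcons !ltnS.
      rewrite cons_uniq rcons_uniq up mem_rcons inE negb_or andbT.
      have -> /= : b \notin y :: p by apply/negP => /Hb; rewrite ltnn.
      rewrite andbT; apply/andP; split; first by apply/negP => /eqP E; rewrite E ltnn in ba.
      by apply/negP => /Hb; lia.
    case=> [|i]; first by [].
    rewrite /= size_rcons /= -rcons_cons !nth_rcons /= !ltnS => ik.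
    have -> : i <= size p by lia.
    case: (ltnP i (size p)) => ip.
      by move: Hp => /(pathP ord0) /(_ i ip) /and3P[].
    have -> : i = size p by lia.
    rewrite eqxx setUC.
    by rewrite -[size p]/(size (y :: p)).-1 nth_last /= -zE.
  have vi i : i <= size p -> nth ord0 [:: a, y & rcons p b] i.+1 < b.
    by move=> ip; rewrite /= nthp //; apply/Hb/mem_nth.
  have lastb : nth ord0 (rcons p b) (size p) = b by rewrite nth_rcons ltnn eqxx.
  rewrite /= size_rcons /=; split.
  + case=> // i ik; case: (leqP i (size p)) => ip; first by have := vi i ip; lia.
    have -> : i = (size p).+1 by lia.
    by rewrite /= lastb; lia.
  + case=> // i ik; rewrite lastb.
    case: (leqP i (size p)) => ip; first by have := vi i ip; lia.
    have -> : i = (size p).+1 by lia.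
    by rewrite /= lastb.
  + rewrite -rcons_cons nth_rcons /= ltnS leqnn.
    by rewrite -[size p]/(size (y :: p)).-1 nth_last /= -zE.
Qed.

(** * Faces and facets: extension, the top edge, spanning, small vertex sets *)

Lemma faceP V F : face V F <-> F \subset edgesK V /\ ~ forb F.
Proof. by split=> -[? nf]; split=> // /forbP. Qed.

Lemma neq_ltn_ord u v : (u != v) = (u < v) || (v < u).
Proof. by rewrite -neq_ltn. Qed.

Lemma edge_in V F u v :
  F \subset edgesK V -> [set u; v] \in F -> [/\ u \in V, v \in V & u != v].
Proof.
move=> /subsetP sub /sub; rewrite inE cards2 subUset !sub1set => /andP[/andP[uV vV]].
by case: (u != v).
Qed.

Lemma edgeK_in V u v : u \in V -> v \in V -> u != v -> [set u; v] \in edgesK V.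
Proof. by move=> uV vV uv; rewrite inE cards2 uv subUset !sub1set uV vV. Qed.

Lemma edge_ex V F e : F \subset edgesK V -> e \in F -> exists u v, e = [set u; v].
Proof. by move=> /subsetP sub /sub; rewrite inE => /andP[_ /cards2P[u [v [_ ->]]]]; exists u, v. Qed.

Lemma edgesK_sub V W : V \subset W -> edgesK V \subset edgesK W.
Proof. by move=> VW; apply/subsetP => e; rewrite !inE => /andP[/subset_trans-> //]. Qed.

Lemma forbS F G : F \subset G -> forb F -> forb G.
Proof.
move=> sub [a [b [y [z [[zy yb ba ay bz] c]]]]].
by exists a, b, y, z; split; [split=> //; exact: (subsetP sub)|exact: connS c _ sub].
Qed.

Lemma faceS V F G : face V F -> G \subset F -> face V G.
Proof.
move=> /faceP[FV nf] GF; apply/faceP; split; first exact: subset_trans FV.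
by move/(forbS GF).
Qed.

Definition induced F W := [set e in F | e \subset W].

Lemma induced_sub F W : induced F W \subset F.
Proof. by apply/subsetP => e; rewrite inE => /andP[]. Qed.

Lemma face_induced V F W : face V F -> face W (induced F W).
Proof.
move=> fF; have [_ nf] := faceS fF (induced_sub F W); split=> //.
have [/subsetP FV _] := fF; apply/subsetP => e; rewrite !inE => /andP[/FV].
by rewrite inE => /andP[_ ->] ->.
Qed.

Lemma facet_face V F : facet V F -> face V F.
Proof. by case. Qed.

Lemma facet_edges V F : facet V F -> F \subset edgesK V.
Proof. by case=> -[]. Qed.

Lemma facet_ext V F : face V F -> exists G, facet V G /\ F \subset G.
Proof.
have [k] := ubnP (#|edgesK V| - #|F|); elim: k F => // k IH F le_k fF.
case: (excluded_middle_informative (exists G, face V G /\ F \proper G)) => [[G [fG FG]]|nG].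
  have [|H [fH GH]] := IH G _ fG; last by exists H; split=> //; apply: subset_trans (proper_sub FG) GH.
  have := proper_card FG; have [/subset_leq_card + _] := fG; lia.
exists F; split=> //; split=> // G fG FG; apply/eqP; rewrite eq_sym eqEproper FG /=.
by apply/negP => pFG; apply: nG; exists G.
Qed.

Lemma card_gt1_in V : 1 < #|V| -> exists a, a \in V.
Proof. by move=> V1; apply/card_gt0P; apply: ltnW. Qed.

Lemma mino_lt_maxo V : 1 < #|V| -> mino V < maxo V.
Proof.
move=> V1; case/card_gt1P: (V1) => a [b [aV bV]]; rewrite neq_ltn_ord.
have := mino_le aV; have := mino_le bV; have := maxo_ge aV; have := maxo_ge bV; olia.
Qed.

Definition top_edge V : {set T} := [set mino V; maxo V].

(** In a pattern [z < y < b < a], [y] is not the minimum and [b] not the maximum of [V], so the top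
    edge is neither [ay] nor [bz]. It is not on the route either, since its larger end is not below
    [b]. *)
Lemma face_add_top V F : 1 < #|V| -> face V F -> face V (top_edge V |: F).
Proof.
move=> V1 /faceP[FV nf]; have mM := mino_lt_maxo V1; have [c cV] := card_gt1_in V1.
have F'V : top_edge V |: F \subset edgesK V.
  rewrite subUset FV andbT sub1set edgeK_in ?(mino_in cV) ?(maxo_in cV) //.
  by rewrite neq_ltn_ord mM.
apply/faceP; split=> // -[a [b [y [z [[zy yb ba ay bz] c1]]]]]; apply: nf.
have [aV yV _] := edge_in F'V ay; have [bV zV _] := edge_in F'V bz.
have aM := maxo_ge aV; have mz := mino_le zV.
have old (s t : T) : s < b -> t < b -> [set s; t] \in top_edge V |: F -> [set s; t] \in F.
  move=> sb tb /setU1P[|//] /set2_eqP[[_ E]|[E _]]; rewrite E in sb tb; olia.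
exists a, b, y, z; split; last exact: conn_sub c1 (leqnn _) old.
split=> //.
  by case/setU1P: ay => // /set2_eqP[[_ E]|[_ E]]; rewrite E in zy yb; olia.
by case/setU1P: bz => // /set2_eqP[[E1 E]|[E E1]]; rewrite E in zy yb ba; rewrite ?E1 in zy yb ba; olia.
Qed.

Lemma facet_top V F : 1 < #|V| -> facet V F -> top_edge V \in F.
Proof. by move=> V1 [fF mF]; rewrite -(mF _ (face_add_top V1 fF)) ?setU11 ?subsetU1. Qed.

Lemma VE_sub V F : F \subset edgesK V -> VE F \subset V.
Proof.
by move=> /subsetP sub; apply/bigcupsP => e /sub; rewrite inE => /andP[].
Qed.

Lemma in_VE F e v : e \in F -> v \in e -> v \in VE F.
Proof. by move=> eF ve; apply/bigcupP; exists e. Qed.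

(** An isolated vertex [v] could be joined to [maxo V]: a pattern can use the new edge only as [ay]
    with [y = v], and no route below [b] leaves [v]. *)
Lemma facet_VE V F : 1 < #|V| -> facet V F -> VE F = V.
Proof.
move=> V1 fF; have [/faceP[FV nf] mF] := fF; have top := facet_top V1 fF.
apply/eqP; rewrite eqEsubset VE_sub //=; apply/subsetP => v vV; apply/negPn/negP => vF.
have MF : maxo V \in VE F by apply: in_VE top _; rewrite set22.
have vM : v < maxo V.
  have := maxo_ge vV; rewrite leq_eqVlt => /predU1P[/val_inj E|//].
  by rewrite E MF in vF.
set e := [set v; maxo V].
have iso w : [set v; w] \notin F.
  by apply/negP => vw; case/negP: vF; apply: in_VE vw _; rewrite set21.
have eF : e \notin F by exact: iso.
suff fE : face V (e |: F) by rewrite -(mF _ fE) ?setU11 ?subsetU1 in eF.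
have F'V : e |: F \subset edgesK V.
  rewrite subUset FV andbT sub1set edgeK_in //; first exact: maxo_in vV.
  by rewrite neq_ltn_ord vM.
apply/faceP; split=> // -[a [b [y [z [[zy yb ba ay bz] c1]]]]].
have [aV yV _] := edge_in F'V ay; have aM := maxo_ge aV.
have old (s t : T) : s < b -> t < b -> [set s; t] \in e |: F -> [set s; t] \in F.
  by move=> sb tb /setU1P[|//] /set2_eqP[[_ E]|[E _]]; rewrite E in sb tb; olia.
have c2 : conn F b y z := conn_sub c1 (leqnn _) old.
have yv : y <> v.
  move=> E; rewrite {}E in c2 zy.
  suff E : v = z by rewrite E ltnn in zy.
  apply: (conn_inv (P := fun w => v = w) c2) => // s t <- vt.
  by rewrite (negPf (iso t)) in vt.
apply: nf; exists a, b, y, z; split=> //; split=> //.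
  by case/setU1P: ay => // /set2_eqP[[_ E]|[_ E]] //; rewrite E in zy yb; olia.
case/setU1P: bz => // /set2_eqP[[_ E]|[E _]]; rewrite E in zy yb ba; olia.
Qed.

(** A pattern has four distinct vertices, so here the complete graph is a face. *)
Lemma facet_small V F : #|V| <= 3 -> facet V F -> F = edgesK V.
Proof.
move=> V3 [fF mF]; have [FV _] := fF; apply/esym/mF => //; apply/faceP; split=> //.
move=> [a [b [y [z [[zy yb ba ay bz] _]]]]].
have [aV yV _] := edge_in (subxx _) ay; have [bV zV _] := edge_in (subxx _) bz.
have : #|[set a; b; y; z]| <= #|V|.
  by apply: subset_leq_card; rewrite !subUset !sub1set aV bV yV zV.
rewrite -!setUA !cardsU1 cards1 !inE !negb_or.
have ne (s t : T) : s < t -> (s != t) && (t != s) by rewrite !neq_ltn_ord => ->; rewrite orbT.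
have /andP[_ ->] := ne _ _ zy; have /andP[_ ->] := ne _ _ yb; have /andP[_ ->] := ne _ _ ba.
have /andP[_ ->] : (z != b) && (b != z) by apply: ne; lia.
have /andP[_ ->] : (z != a) && (a != z) by apply: ne; lia.
have /andP[_ ->] : (y != a) && (a != y) by apply: ne; lia.
by move/leq_trans/(_ V3).
Qed.

(** * Cutting a vertex set at one vertex *)

(** The vertex part of a decomposition: [V1] is the older side, [V2] the younger one. The last two
    fields give both sides at least two vertices and keep the top edge of [V] out of both. *)
Record cut V V1 V2 x : Prop := Cut {
  cutU : V1 :|: V2 = V;
  cutI : V1 :&: V2 = [set x];
  cut_m : mino V \in V1;
  cut_M : maxo V \in V2;
  cut_le : forall v, v \in V1 -> v <= x;
  cut_mx : mino V != x;
  cut_xM : x != maxo V }.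

Section Cut.
Variables (V V1 V2 : {set T}) (x : T).
Hypothesis cutV : cut V V1 V2 x.

Lemma cut_x1 : x \in V1.
Proof. by have /setP/(_ x) := cutI cutV; rewrite !inE eqxx => /andP[]. Qed.

Lemma cut_x2 : x \in V2.
Proof. by have /setP/(_ x) := cutI cutV; rewrite !inE eqxx => /andP[]. Qed.

Lemma cut_sub1 : V1 \subset V.
Proof. by rewrite -(cutU cutV) subsetUl. Qed.

Lemma cut_sub2 : V2 \subset V.
Proof. by rewrite -(cutU cutV) subsetUr. Qed.

Lemma cut_both v : v \in V1 -> v \in V2 -> v = x.
Proof. by move=> v1 v2; apply/set1P; rewrite -(cutI cutV) inE v1. Qed.

Lemma cut_either v : v \in V -> v \in V1 \/ v \in V2.
Proof. by rewrite -(cutU cutV) => /setUP. Qed.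

Lemma cut_m2 : mino V \notin V2.
Proof. by apply/negP => /(cut_both (cut_m cutV))/eqP; apply/negP/(cut_mx cutV). Qed.

Lemma cut_M1 : maxo V \notin V1.
Proof. by apply/negP => /cut_both/(_ (cut_M cutV))/eqP; rewrite eq_sym; apply/negP/(cut_xM cutV). Qed.

Lemma cut_lt_m : mino V < x.
Proof. by have := cut_le cutV (cut_m cutV); rewrite leq_eqVlt => /predU1P[/val_inj/eqP|//]; rewrite (negPf (cut_mx cutV)). Qed.

Lemma cut_lt_M : x < maxo V.
Proof.
have := maxo_ge (subsetP cut_sub1 _ cut_x1); rewrite leq_eqVlt => /predU1P[/val_inj/eqP|//].
by rewrite (negPf (cut_xM cutV)).
Qed.

Lemma cut_lt v : v \in V1 -> v != x -> v < x.
Proof. by move=> /(cut_le cutV); rewrite leq_eqVlt => /predU1P[/val_inj->|//]; rewrite eqxx. Qed.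

Lemma cut_max1 : maxo V1 = x.
Proof. exact: maxo_eq cut_x1 (cut_le cutV). Qed.

Lemma cut_min1 : mino V1 = mino V.
Proof. by apply: mino_eq (cut_m cutV) _ => b /(subsetP cut_sub1)/mino_le. Qed.

Lemma cut_max2 : maxo V2 = maxo V.
Proof. by apply: maxo_eq (cut_M cutV) _ => b /(subsetP cut_sub2)/maxo_ge. Qed.

Lemma cut_gt1 : 1 < #|V1|.
Proof. by apply/card_gt1P; exists (mino V), x; rewrite cut_x1 (cut_m cutV) (cut_mx cutV). Qed.

Lemma cut_gt2 : 1 < #|V2|.
Proof. by apply/card_gt1P; exists x, (maxo V); rewrite cut_x2 (cut_M cutV) (cut_xM cutV). Qed.

Lemma cut_card : (#|V1| + #|V2|)%N = #|V|.+1.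
Proof. by rewrite -cardsUI (cutU cutV) (cutI cutV) cards1 addn1. Qed.

Lemma cut_top1 : top_edge V1 = [set mino V; x].
Proof. by rewrite /top_edge cut_min1 cut_max1. Qed.

Lemma cut_top2 : top_edge V2 = [set mino V2; maxo V].
Proof. by rewrite /top_edge cut_max2. Qed.

End Cut.

(** With [cut_max1] this shows that the older side alone determines the cut. *)
Lemma cut_V2 V V1 V2 x : cut V V1 V2 x -> V2 = V :\: (V1 :\ x).
Proof.
move=> c; apply/setP => v; rewrite -(cutU c) !inE.
case v1: (v \in V1); case v2: (v \in V2); rewrite ?andbF ?andbT //=.
  by rewrite (cut_both c v1 v2) eqxx.
by case: eqP => // E; rewrite E (cut_x2 c) in v2.
Qed.

(** An edge of [F2] inside [V1] would have both ends equal to [x], so each side can be recovered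
    from the whole as an induced subgraph. *)
Lemma cut_induced1 V V1 V2 x F1 F2 e : cut V V1 V2 x ->
  F1 \subset edgesK V1 -> F2 \subset edgesK V2 -> e \in F1 :|: F2 :|: [set top_edge V] ->
  (e \in F1) = (e \subset V1).
Proof.
move=> c s1 s2 eF; apply/idP/idP => [/(subsetP s1)|e1]; first by rewrite inE => /andP[].
case/setUP: eF => [/setUP[//|eF2]|/set1P E]; last first.
  by have := subsetP e1 (maxo V); rewrite E set22 (negPf (cut_M1 c)) => /(_ isT).
have [u [v E]] := edge_ex s2 eF2; rewrite E in e1 eF2.
have [u2 v2] := edge_in s2 eF2.
move: e1; rewrite subUset !sub1set => /andP[u1 v1].
by rewrite (cut_both c u1 u2) (cut_both c v1 v2) eqxx.
Qed.

Lemma cut_induced2 V V1 V2 x F1 F2 e : cut V V1 V2 x ->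
  F1 \subset edgesK V1 -> F2 \subset edgesK V2 -> e \in F1 :|: F2 :|: [set top_edge V] ->
  (e \in F2) = (e \subset V2).
Proof.
move=> c s1 s2 eF; apply/idP/idP => [/(subsetP s2)|e2]; first by rewrite inE => /andP[].
case/setUP: eF => [/setUP[eF1|//]|/set1P E]; last first.
  by have := subsetP e2 (mino V); rewrite E set21 (negPf (cut_m2 c)) => /(_ isT).
have [u [v E]] := edge_ex s1 eF1; rewrite E in e2 eF1.
have [u1 v1] := edge_in s1 eF1.
move: e2; rewrite subUset !sub1set => /andP[u2 v2].
by rewrite (cut_both c u1 u2) (cut_both c v1 v2) eqxx.
Qed.

(* A path that leaves V2 must come back through the cut vertex x. *)
Lemma face_glue V1 V2 x F1 F2 :
  V1 :&: V2 = [set x] -> (forall v, v \in V1 -> v <= x) ->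
  face V1 F1 -> face V2 F2 -> face (V1 :|: V2) (F1 :|: F2).
Proof.
move=> /setP I le_x /faceP[s1 n1] /faceP[s2 n2].
have both v : v \in V1 -> v \in V2 -> v = x by move=> v1 v2; apply/set1P; rewrite -I inE v1.
apply/faceP; split.
  rewrite subUset; apply/andP; split.
    by apply: subset_trans s1 _; apply/edgesK_sub/subsetUl.
  by apply: subset_trans s2 _; apply/edgesK_sub/subsetUr.
move=> [a [b [y [z [[zy yb ba ay bz] c]]]]].
(* If [ay] is an edge of [F1], then [b < a <= x], so the route below [b] misses [x] and stays in
   [V1]. *)
case/setUP: ay => ay.
  have [a1 y1 _] := edge_in s1 ay; have ax := le_x _ a1.
  have lt2 v : v \in V1 -> v < b -> v \notin V2.
    by move=> v1 vb; apply/negP => /(both _ v1) E; rewrite E in vb; olia.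
  have old (s t : T) : s < b -> s \in V1 -> [set s; t] \in F1 :|: F2 -> [set s; t] \in F1.
    by move=> sb sV1 /setUP[//|/(edge_in s2)[sV2]]; rewrite (negPf (lt2 _ sV1 sb)) in sV2.
  have [z1 c1] : z \in V1 /\ conn F1 b y z.
    apply: (conn_inv (P := fun w => w \in V1 /\ conn F1 b y w) c); first by split=> //; apply: connect0.
    move=> s t [sV1 cs] st sb tb; have st1 := old _ _ sb sV1 st; have [_ t1 _] := edge_in s1 st1.
    by split=> //; apply: conn_trans cs _; apply: conn_edge.
  apply: n1; exists a, b, y, z; split=> //; split=> //.
  by rewrite setUC; apply: old; rewrite 1?setUC //; olia.
have [a2 y2 _] := edge_in s2 ay.
(* Now the route starts in [V2]. While it is in [V1], the invariant remembers that [x] has been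
   reached within [F2]. *)
have Pz : (z \in V2 /\ conn F2 b y z) \/ (z \in V1 /\ conn F2 b y x).
  apply: (conn_inv (P := fun w => (w \in V2 /\ conn F2 b y w) \/ (w \in V1 /\ conn F2 b y x)) c).
    by left; split=> //; apply: connect0.
  move=> s t Ps /setUP[] st sb tb.
    have [sV1 tV1 _] := edge_in s1 st; right; split=> //.
    by case: Ps => [[sV2 cs]|[]] //; rewrite -(both s).
  have [sV2 tV2 _] := edge_in s2 st; left; split=> //.
  have cs : conn F2 b y s by case: Ps => [[]|[sV1 cs]] //; rewrite (both s).
  by apply: conn_trans cs _; apply: conn_edge.
have zc : z \in V2 -> conn F2 b y z by case: Pz => [[]|[z1 c1 z2]] //; rewrite (both z).
case/setUP: bz => bz.
  have [b1 z1 _] := edge_in s1 bz; have bx := le_x _ b1.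
  suff : x < b by olia.
  case: Pz => [[z2 _]|[_ cx]]; last exact: conn_lt cx yb.
  by rewrite -(both z) //; olia.
by have [b2 z2 _] := edge_in s2 bz; apply: n2; exists a, b, y, z; split; [|exact: zc].
Qed.

Lemma face_join V V1 V2 x F1 F2 : cut V V1 V2 x ->
  face V1 F1 -> face V2 F2 -> face V (F1 :|: F2 :|: [set top_edge V]).
Proof.
move=> c f1 f2; rewrite setUC; apply: face_add_top.
  by apply: leq_trans (subset_leq_card (cut_sub1 c)); apply: cut_gt1 c.
by rewrite -(cutU c); apply: face_glue (cutI c) (cut_le c) f1 f2.
Qed.

(** * Decomposition of facets along a cut *)

(** Working form of [is_decomp], with the vertex sets and the cut vertex as explicit parameters. *)
Definition dec V F F1 F2 V1 V2 x :=
  [/\ cut V V1 V2 x, facet V1 F1, facet V2 F2 & F = F1 :|: F2 :|: [set top_edge V]].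

Lemma decomp_dec V F F1 F2 : 1 < #|V| ->
  is_decomp V F F1 F2 -> dec V F F1 F2 (VE F1) (VE F2) (maxo (VE F1)).
Proof.
move=> V1 [[f1 f2 U I] [m1 M2 E _]]; rewrite in_setU negb_or => /andP[n1 _].
split=> //.
have [e eF1 me] := bigcupP m1.
have gt1 : 1 < #|VE F1|.
  have [u [v Ee]] := edge_ex (facet_edges f1) eF1; rewrite Ee in eF1.
  have [u1 v1 uv] := edge_in (facet_edges f1) eF1.
  by apply/card_gt1P; exists u, v.
have sub1 v : v \in VE F1 -> v \in V by rewrite -U inE => ->.
have min1 : mino (VE F1) = mino V by apply: mino_eq m1 _ => b /sub1/mino_le.
split=> //; first by move=> v; apply: maxo_ge.
  by have := mino_lt_maxo gt1; rewrite min1 neq_ltn_ord => ->.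
(* Otherwise the top edge of [V] would be the top edge of the older side, which the facet [F1]
   contains. *)
apply/negP => /eqP max1; case/negP: n1.
by rewrite -{1}min1 -max1; exact: facet_top.
Qed.

Lemma dec_decomp V F F1 F2 V1 V2 x :
  dec V F F1 F2 V1 V2 x -> is_decomp V F F1 F2.
Proof.
move=> [c f1 f2 E]; have VE1 := facet_VE (cut_gt1 c) f1; have VE2 := facet_VE (cut_gt2 c) f2.
rewrite /is_decomp VE1 VE2 (cut_max1 c) (cutU c) (cutI c) (cut_m c) (cut_M c).
split=> //; split=> //.
  rewrite -setI_eq0; apply/eqP/setP => e; rewrite in_setI in_set0; apply/negP => /andP[e1 e2].
  have [u [v Ee]] := edge_ex (facet_edges f1) e1; rewrite Ee in e1 e2.
  have [u1 v1 +] := edge_in (facet_edges f1) e1; have [u2 v2 _] := edge_in (facet_edges f2) e2.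
  by rewrite (cut_both c u1 u2) (cut_both c v1 v2) eqxx.
rewrite in_setU negb_or; apply/andP; split; apply/negP.
  by case/(edge_in (facet_edges f1)) => _; rewrite (negPf (cut_M1 c)).
by case/(edge_in (facet_edges f2)); rewrite (negPf (cut_m2 c)).
Qed.

Lemma cut_of_set V C x : 1 < #|V| ->
  C \subset V -> x \in V -> x != maxo V -> mino V \in C ->
  (forall u, u \in C -> u < x) -> cut V (x |: C) (V :\: C) x.
Proof.
move=> V1 /subsetP CV xV xM mC ltx.
have xC : x \notin C by apply/negP => /ltx; rewrite ltnn.
split=> //.
- apply/setP => v; rewrite !inE; case vC: (v \in C); rewrite ?orbT /=; first by rewrite CV.
  by case: eqP => // ->.
- by apply/setP => v; rewrite !inE; case: eqP => [->|_] /=; [rewrite xC xV|case: (v \in C)].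
- by rewrite in_setU mC orbT.
- rewrite in_setD (maxo_in xV) andbT; apply/negP => /ltx; have := maxo_ge xV; olia.
- by move=> v /setU1P[->|/ltx/ltnW].
- by rewrite neq_ltn_ord ltx.
Qed.

(** Under the last hypothesis every edge of [F] lies in [V1], lies in [V2] or is the top edge, and
    the two induced faces extend to facets independently. [F] is only a face, so this also applies
    after an edge has been deleted. *)
Lemma face_cut V F C x :
  let V1 := x |: C in let V2 := V :\: C in
  1 < #|V| -> face V F -> cut V V1 V2 x ->
  (forall u w, u \in C -> w \notin C -> [set u; w] \in F ->
     w = x \/ (u = mino V /\ w = maxo V)) ->
  exists F1 F2, [/\ facet V1 F1, facet V2 F2 & F \subset F1 :|: F2 :|: [set top_edge V]].
Proof.
move=> V1 V2 Vgt1 fF c closed; have [FV _] := fF.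
have [F1 [f1 s1]] := facet_ext (face_induced V1 fF).
have [F2 [f2 s2]] := facet_ext (face_induced V2 fF).
exists F1, F2; split=> //; apply/subsetP => e eF.
have [u [v E]] := edge_ex FV eF; rewrite {}E in eF *; have [uV vV _] := edge_in FV eF.
wlog uC : u v eF uV vV / (v \in C) ==> (u \in C).
  move=> W; case uC: (u \in C); first by apply: W; rewrite // uC implybT.
  by case vC: (v \in C); [rewrite setUC|]; apply: W; rewrite ?uC ?vC // setUC.
case/boolP: (u \in C) uC => uC; rewrite ?implybT ?implybF => vC; last first.
  rewrite setUAC; apply/setUP; right; apply: (subsetP s2).
  by rewrite inE eF subUset !sub1set !inE uC vC uV vV.
case/boolP: (v \in C) vC => vC _.
  do 2! [apply/setUP; left]; apply: (subsetP s1).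
  by rewrite inE eF subUset !sub1set !inE uC vC !orbT.
case: (closed _ _ uC vC eF) => [E|[-> ->]]; last by rewrite inE set11 orbT.
do 2! [apply/setUP; left]; apply: (subsetP s1).
by rewrite inE eF subUset !sub1set !inE uC E eqxx orbT.
Qed.

(* The cut vertex is the largest neighbour of [mino V] other than [maxo V], and
   the first side is what [mino V] reaches through vertices below it. *)
Lemma facet_dec V F : 2 < #|V| -> facet V F ->
  exists F1 F2 V1 V2 x, dec V F F1 F2 V1 V2 x.
Proof.
move=> V3 fF; have V2 : 1 < #|V| by lia.
have [/faceP[FV nf] mF] := fF; have ltmM := mino_lt_maxo V2.
have [v0 v0V] := card_gt1_in V2.
pose N := [set v | ([set mino V; v] \in F) && (v != maxo V)].
(* Such a cut suffices: [F] then lies in a join of two facets, which is a face, and maximality of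
   [F] gives equality. *)
suff [x [C [c closed]]] : exists x C, cut V (x |: C) (V :\: C) x /\
    (forall u w, u \in C -> w \notin C -> [set u; w] \in F ->
     w = x \/ (u = mino V /\ w = maxo V)).
  have [F1 [F2 [f1 f2 s]]] := face_cut V2 (facet_face fF) c closed.
  exists F1, F2, (x |: C), (V :\: C), x; split=> //; apply/esym/mF => //.
  by apply: face_join c _ _; apply: facet_face.
have mV := mino_in v0V.
(* If [mino V] has no neighbour but possibly [maxo V], any third vertex serves as [x], with [C]
   reduced to [mino V]. *)
have [N0|[v vN]] := set_0Vmem N.
  have /card_gt0P[x] : 0 < #|V :\ mino V :\ maxo V|.
    by move: V3; rewrite (cardsD1 (mino V)) mV (cardsD1 (maxo V)); case: (_ \in _); rewrite ?add1n ?add0n !ltnS //; exact: ltnW.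
  rewrite !inE => /and3P[xM xm xV].
  exists x, [set mino V]; split; first apply: cut_of_set => //.
  - by rewrite sub1set.
  - exact: set11.
  - move=> u /set1P->; have := mino_le xV; rewrite leq_eqVlt => /predU1P[/val_inj E|//].
    by rewrite E eqxx in xm.
  - move=> u w /set1P-> _ mw; right; split=> //; apply/eqP/negPn/negP => wM.
    by have /setP/(_ w) := N0; rewrite !inE mw wM.
pose x := maxo N; have := maxo_in vN; rewrite -/x inE => /andP[mx xM].
have [_ xV mxne] := edge_in FV mx.
have ltmx : mino V < x.
  by have := mino_le xV; rewrite leq_eqVlt => /predU1P[/val_inj/eqP|//]; rewrite (negPf mxne).
pose C := [set w | conn F x (mino V) w].
have ltC w : w \in C -> w < x by rewrite inE => /conn_lt; apply.
exists x, C; split.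
  apply: cut_of_set => //; last by rewrite inE; apply: connect0.
  apply/subsetP => w; rewrite inE => cw; apply: (conn_inv (P := fun w => w \in V) cw) => //.
  by move=> s t _ /(edge_in FV)[].
move=> u w uC wC uw; have ux := ltC _ uC; case: (ltngtP w x) => [wx|xw|/val_inj->]; last by left.
  case/negP: wC; move: uC; rewrite !inE => /conn_trans; apply; exact: conn_edge.
right; case: (eqVneq u (mino V)) => [E|um].
  split=> //; apply/eqP/negPn/negP => wM; suff : w <= x by olia.
  by apply: maxo_ge; rewrite inE -E uw wM.
(* An edge from [u] in [C] to some [w > x] completes a pattern with the edge from [x] to
   [mino V]. *)
case: nf; exists w, x, u, (mino V); split; last by rewrite conn_sym; rewrite inE in uC.
have [uV _ _] := edge_in FV uw; split=> //; last by rewrite setUC.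
  by have := mino_le uV; rewrite leq_eqVlt => /predU1P[/val_inj E|//]; rewrite E eqxx in um.
by rewrite setUC.
Qed.

Lemma decompP V F : 2 < #|V| -> facet V F -> is_decomp V F (decomp V F).1 (decomp V F).2.
Proof.
move=> V3 fF; have [F1 [F2 [V1 [V2 [x d]]]]] := facet_dec V3 fF.
apply: (epsilon_spec (inhabits (set0, set0)) (fun p => is_decomp V F p.1 p.2)).
by exists (F1, F2); apply: dec_decomp d.
Qed.

(** * Induction over decompositions, connectivity in facets, joining facets *)

Lemma facet_ind (P : {set T} -> {set {set T}} -> Prop) :
  (forall V F, #|V| = 2 -> facet V F -> P V F) ->
  (forall V F F1 F2 V1 V2 x, 2 < #|V| -> facet V F ->
     dec V F F1 F2 V1 V2 x -> P V1 F1 -> P V2 F2 -> P V F) ->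
  forall V F, 1 < #|V| -> facet V F -> P V F.
Proof.
move=> P2 Prec V; have [k] := ubnP #|V|; elim: k V => // k IH V le_k F V1 fF.
case: (leqP #|V| 2) => V2; first by apply: P2 => //; lia.
have [F1 [F2 [W1 [W2 [x d]]]]] := facet_dec V2 fF.
have [c f1 f2 _] := d; have := cut_card c; have c1 := cut_gt1 c; have c2 := cut_gt2 c.
by move=> cc; apply: (Prec V F F1 F2 W1 W2 x) => //; apply: IH => //; lia.
Qed.

Lemma dec_sub1 V F F1 F2 V1 V2 x : dec V F F1 F2 V1 V2 x -> F1 \subset F.
Proof. by case=> _ _ _ ->; rewrite -setUA subsetUl. Qed.

Lemma dec_sub2 V F F1 F2 V1 V2 x : dec V F F1 F2 V1 V2 x -> F2 \subset F.
Proof. by case=> _ _ _ ->; rewrite setUAC subsetUr. Qed.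

Lemma dec_mx V F F1 F2 V1 V2 x : dec V F F1 F2 V1 V2 x -> [set mino V; x] \in F1.
Proof. by case=> c f1 _ _; rewrite -(cut_top1 c) facet_top // (cut_gt1 c). Qed.

Lemma set_of_two V : #|V| = 2 -> [set mino V; maxo V] = V.
Proof.
move=> V2; have V1 : 1 < #|V| by rewrite V2.
have [a aV] := card_gt1_in V1; apply/eqP.
rewrite eqEcard subUset !sub1set (mino_in aV) (maxo_in aV) V2 cards2.
by rewrite neq_ltn_ord mino_lt_maxo.
Qed.

Lemma cut_two V V1 V2 x : cut V V1 V2 x -> #|V1| <= 2 -> [set mino V; x] = V1.
Proof.
move=> c V12; rewrite -(cut_min1 c) -(cut_max1 c); apply/set_of_two/eqP.
by rewrite eqn_leq V12 (cut_gt1 c).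
Qed.

Lemma min_of_two V a : #|V| = 2 -> a \in V -> a != maxo V -> a == mino V.
Proof. by move=> V2; rewrite -{1}(set_of_two V2) !inE => /orP[//|->]. Qed.

(** By induction, vertices of the older side reach [mino V] below [x], and those of the younger side
    reach [x] through [mino V2]; the top edge of the older side links [x] to [mino V]. *)
Lemma conn_min V F : 1 < #|V| -> facet V F ->
  forall a, a \in V -> a != maxo V -> conn F (maxo V) a (mino V).
Proof.
move: V F; apply: facet_ind => [V F V2 fF a aV aM|V F F1 F2 V1 V2 x V3 fF d IH1 IH2 a aV aM].
  by rewrite (eqP (min_of_two V2 aV aM)); apply: connect0.
have [c f1 f2 _] := d; have ltM := cut_lt_M c.
have xm : conn F (maxo V) x (mino V).
  apply: conn_edge => //; last by apply: ltn_trans ltM; apply: cut_lt_m c.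
  by rewrite setUC; apply: (subsetP (dec_sub1 d)); apply: dec_mx d.
case: (cut_either c aV) => [a1|a2].
  case: (eqVneq a x) => [->//|ax].
  rewrite (cut_max1 c) (cut_min1 c) in IH1.
  exact: connS (IH1 _ a1 ax) (ltnW ltM) (dec_sub1 d).
rewrite (cut_max2 c) in IH2.
apply: conn_trans (connS (IH2 _ a2 aM) (leqnn _) (dec_sub2 d)) _.
apply: conn_trans xm; rewrite conn_sym.
exact: connS (IH2 _ (cut_x2 c) (cut_xM c)) (leqnn _) (dec_sub2 d).
Qed.

(** For [u] in the younger side, induction in [F2] suffices. For [u] in the older side, compare [b]
    with [x]: if [b < x], use induction in [F1]; if [x < b], go to [x] and continue in [F2]; if
    [b = x], go to [mino V] and take the top edge. *)
Lemma conn_first_above V F : 1 < #|V| -> facet V F ->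
  forall u (b : T), u \in V -> u < b -> b < maxo V ->
  exists a y, [/\ conn F b u y, [set a; y] \in F & b < a].
Proof.
move: V F; apply: facet_ind => [V F V2 fF u b uV ub bM|V F F1 F2 V1 V2 x V3 fF d IH1 IH2 u b uV ub bM].
  have V1 : 1 < #|V| by rewrite V2.
  have uM : u != maxo V by rewrite neq_ltn_ord; apply/orP; left; olia.
  have E := eqP (min_of_two V2 uV uM).
  exists (maxo V), u; split=> //; first exact: connect0.
  by rewrite E setUC; apply: facet_top.
have [c f1 f2 FE] := d; rewrite (cut_max1 c) in IH1; rewrite (cut_max2 c) in IH2.
case: (cut_either c uV) => [u1|u2]; last first.
  have [a [y [cy ay ba]]] := IH2 _ _ u2 ub bM.
  exists a, y; split=> //; first exact: connS cy (leqnn _) (dec_sub2 d).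
  exact: (subsetP (dec_sub2 d)).
have := conn_min (cut_gt1 c) f1 u1; rewrite (cut_max1 c) (cut_min1 c) => um.
case: (ltngtP b x) => [bx|xb|/val_inj E].
- have [a [y [cy ay ba]]] := IH1 _ _ u1 ub bx.
  exists a, y; split=> //; first exact: connS cy (leqnn _) (dec_sub1 d).
  exact: (subsetP (dec_sub1 d)).
- have [a [y [cy ay ba]]] := IH2 _ _ (cut_x2 c) xb bM.
  exists a, y; split=> //; last exact: (subsetP (dec_sub2 d)).
  apply: conn_trans (connS cy (leqnn _) (dec_sub2 d)).
  case: (eqVneq u x) => [->|ux]; first exact: connect0.
  apply: conn_trans (connS (um ux) (ltnW xb) (dec_sub1 d)) _.
  apply: conn_edge => //; last by apply: ltn_trans (cut_lt_m c) xb.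
  by apply: (subsetP (dec_sub1 d)); apply: dec_mx d.
- exists (maxo V), (mino V); split=> //; last by rewrite FE !inE setUC eqxx orbT.
  rewrite E; apply: connS (um _) (leqnn _) (dec_sub1 d).
  by rewrite neq_ltn_ord -E ub.
Qed.

(** By maximality of [F1] and [F2], a larger face [G] can gain only edges between the two sides that
    avoid [x]; [key] shows that each of these except the top edge would complete a pattern in
    [G]. *)
Lemma facet_join V V1 V2 x F1 F2 : cut V V1 V2 x ->
  facet V1 F1 -> facet V2 F2 -> facet V (F1 :|: F2 :|: [set top_edge V]).
Proof.
move=> c f1 f2; set F := _ :|: [set _].
have fF : face V F by apply: face_join c _ _; apply: facet_face.
split=> // G /[dup] fG /faceP[GV nf] FG; apply/eqP; rewrite eqEsubset FG andbT.
have ltM := cut_lt_M c; have ltm := cut_lt_m c.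
have sub1 : F1 \subset G by apply: subset_trans FG; rewrite /F -setUA subsetUl.
have sub2 : F2 \subset G by apply: subset_trans FG; rewrite /F setUAC subsetUr.
have mx : [set mino V; x] \in G.
  by apply: (subsetP sub1); rewrite -(cut_top1 c) facet_top // (cut_gt1 c).
have old W K : facet W K -> K \subset G -> forall e, e \in G -> e \subset W -> e \in K.
  move=> [[KW _] mK] KG e eG eW; rewrite -(mK _ (face_induced W fG)); first by rewrite inE eG.
  apply/subsetP => k kK; rewrite inE (subsetP KG) //=.
  by have := subsetP KW _ kK; rewrite inE => /andP[].
have inF1 e : e \in F1 -> e \in F by rewrite !inE => ->.
have inF2 e : e \in F2 -> e \in F by rewrite !inE => ->; rewrite orbT.
have cm a : a \in V1 -> a != x -> conn G x a (mino V).
  move=> a1 ax; have := conn_min (cut_gt1 c) f1 a1; rewrite (cut_max1 c) (cut_min1 c) => ca.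
  exact: connS (ca ax) (leqnn _) sub1.
(* [mino V < y] holds because [y] is in [V2]; it allows [mino V] to play the role of [z] below. *)
have up u (b : T) : u \in V2 -> u < b -> b < maxo V ->
    exists a y, [/\ conn G b u y, [set a; y] \in G, b < a & mino V < y].
  move=> u2 ub; rewrite -(cut_max2 c) => bM.
  have [a [y [cy ay ba]]] := conn_first_above (cut_gt2 c) f2 u2 ub bM.
  have [_ y2 _] := edge_in (facet_edges f2) ay.
  exists a, y; split=> //; [exact: connS cy (leqnn _) sub2|exact: (subsetP sub2)|].
  have := mino_le (subsetP (cut_sub2 c) _ y2); rewrite leq_eqVlt => /predU1P[/val_inj E|//].
  by have := cut_m2 c; rewrite E y2.
have key a b : a \in V1 -> a \notin V2 -> b \in V2 -> b \notin V1 ->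
    [set a; b] \in G -> [set a; b] \in F.
  move=> a1 a2 b2 b1 ab.
  have ax : a != x by apply: contraNneq a2 => ->; apply: cut_x2 c.
  have bx : b != x by apply: contraNneq b1 => ->; apply: cut_x1 c.
  have lta := cut_lt c a1 ax; have ca := cm _ a1 ax.
  have bM := maxo_ge (subsetP (cut_sub2 c) _ b2).
  have ma := mino_le (subsetP (cut_sub1 c) _ a1).
  case: (eqVneq a (mino V)) => [E|am].
    case: (eqVneq b (maxo V)) => [E'|bM']; first by rewrite E E' !inE eqxx orbT.
    have {}bM : b < maxo V by move: bM'; rewrite neq_ltn_ord => /orP[//|]; olia.
    (* The larger of [b] and [x] becomes the last vertex of the path; the smaller one reaches [y] by
       [up] and is adjacent to [mino V]. *)
    case: nf; move: bx; rewrite neq_ltn_ord => /orP[bx|xb].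
      have [a' [y [cy ay ba my]]] := up _ _ b2 bx ltM.
      exists a', x, y, (mino V); split; first (split=> //; last by rewrite setUC).
        exact: conn_lt cy bx.
      rewrite conn_sym -E; apply: conn_trans cy; exact: conn_edge.
    have [a' [y [cy ay ba my]]] := up _ _ (cut_x2 c) xb bM.
    exists a', b, y, (mino V); split; first (split=> //; last by rewrite setUC -E).
      exact: conn_lt cy xb.
    rewrite conn_sym; apply: conn_trans cy; apply: conn_edge => //; olia.
  case: nf; have {}ma : mino V < a by move: am; rewrite neq_ltn_ord => /orP[|//]; olia.
  (* If [b < x], then [mino V] reaches [b] through [a]. If [x < b], the new edge already leads above
     [x] and itself serves as the first edge of the path. *)
  move: bx; rewrite neq_ltn_ord => /orP[bx|xb].
    have [a' [y [cy ay ba my]]] := up _ _ b2 bx ltM.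
    exists a', x, y, (mino V); split; first (split=> //; last by rewrite setUC).
      exact: conn_lt cy bx.
    rewrite conn_sym; apply: conn_trans cy; apply: conn_trans (_ : conn G x _ a) _.
      by rewrite conn_sym.
    exact: conn_edge.
  exists b, x, a, (mino V); split=> //; split=> //; by rewrite setUC.
apply/subsetP => e eG; have [u [v E]] := edge_ex GV eG; rewrite {}E in eG *.
have [uV vV _] := edge_in GV eG.
have both1 a b : [set a; b] \in G -> a \in V1 -> b \in V1 -> [set a; b] \in F.
  by move=> ab a1 b1; apply/inF1/(old V1) => //; rewrite subUset !sub1set a1.
have both2 a b : [set a; b] \in G -> a \in V2 -> b \in V2 -> [set a; b] \in F.
  by move=> ab a2 b2; apply/inF2/(old V2) => //; rewrite subUset !sub1set a2.
case/boolP: (u \in V1) => u1; case/boolP: (v \in V1) => v1; first exact: both1.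
- case: (cut_either c vV) => v2; first by rewrite v2 in v1.
  by case/boolP: (u \in V2) => u2; [exact: both2|exact: key].
- case: (cut_either c uV) => u2; first by rewrite u2 in u1.
  case/boolP: (v \in V2) => v2; first exact: both2.
  by rewrite setUC; apply: key; rewrite // setUC.
- case: (cut_either c vV) => v2; first by rewrite v2 in v1.
  case: (cut_either c uV) => u2; first by rewrite u2 in u1.
  exact: both2.
Qed.

(** * Uniqueness of the decomposition *)

Lemma dec_gt2 V F F1 F2 V1 V2 x : dec V F F1 F2 V1 V2 x -> 2 < #|V|.
Proof.
by case=> c _ _ _; have := cut_card c; have := cut_gt1 c; have := cut_gt2 c; lia.
Qed.

Lemma dec_facet V F F1 F2 V1 V2 x : dec V F F1 F2 V1 V2 x -> facet V F.
Proof. by case=> c f1 f2 ->; apply: facet_join c f1 f2. Qed.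

Lemma dec_edge V F F1 F2 V1 V2 x u v : dec V F F1 F2 V1 V2 x ->
  u \in V1 -> u != x -> [set u; v] \in F ->
  [set u; v] \in F1 \/ (u = mino V /\ v = maxo V).
Proof.
case=> c f1 f2 ->; move=> u1 ux /setUP[/setUP[|uv]|/set1P]; first by left.
  have [u2 _ _] := edge_in (facet_edges f2) uv.
  by rewrite (cut_both c u1 u2) eqxx in ux.
by case/set2_eqP=> [|[E _]]; [right|rewrite E (negPf (cut_M1 c)) in u1].
Qed.

Lemma dec_mem1 V F F1 F2 V1 V2 x e : dec V F F1 F2 V1 V2 x ->
  (e \in F1) = (e \in F) && (e \subset V1).
Proof.
move=> d; have [c f1 f2 FE] := d; case eF: (e \in F).
  by rewrite FE in eF; apply: cut_induced1 c (facet_edges f1) (facet_edges f2) eF.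
by apply: contraFF eF; apply: (subsetP (dec_sub1 d)).
Qed.

Lemma dec_mem2 V F F1 F2 V1 V2 x e : dec V F F1 F2 V1 V2 x ->
  (e \in F2) = (e \in F) && (e \subset V2).
Proof.
move=> d; have [c f1 f2 FE] := d; case eF: (e \in F).
  by rewrite FE in eF; apply: cut_induced2 c (facet_edges f1) (facet_edges f2) eF.
by apply: contraFF eF; apply: (subsetP (dec_sub2 d)).
Qed.

Lemma dec_min_nbr V F F1 F2 V1 V2 x v : dec V F F1 F2 V1 V2 x ->
  [set mino V; v] \in F -> v != maxo V -> v \in V1.
Proof.
move=> d mv vM; have [c f1 _ _] := d.
case: (dec_edge d (cut_m c) (cut_mx c) mv) => [/(edge_in (facet_edges f1))[]//|[_ E]].
by rewrite E eqxx in vM.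
Qed.

(** Edges at vertices of [V1] other than [x] stay in [V1], except for the top edge, whose end
    [maxo V] is above [x]. Together with [dec_conn_side], this makes [V1] without [x] the component
    of [mino V] below [x]. *)
Lemma dec_conn V F F1 F2 V1 V2 x (k : nat) v : dec V F F1 F2 V1 V2 x ->
  k <= x -> conn F k (mino V) v -> v \in V1.
Proof.
move=> d kx cv; have [c f1 _ _] := d.
apply: (conn_inv (P := fun w => w \in V1) cv) => [|s t s1 st sk tk]; first exact: cut_m c.
have sx : s != x by rewrite neq_ltn_ord (leq_trans sk kx).
case: (dec_edge d s1 sx st) => [/(edge_in (facet_edges f1))[]//|[_ E]].
by have := cut_lt_M c; rewrite E in tk; olia.
Qed.

Lemma dec_conn_side V F F1 F2 V1 V2 x v : dec V F F1 F2 V1 V2 x ->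
  v \in V1 -> v != x -> conn F x (mino V) v.
Proof.
move=> d v1 vx; have [c f1 _ _] := d; rewrite conn_sym.
have := conn_min (cut_gt1 c) f1 v1; rewrite (cut_max1 c) (cut_min1 c) => /(_ vx) cv.
exact: connS cv (leqnn _) (dec_sub1 d).
Qed.

(** The cut vertex is the largest neighbour of [mino V] other than [maxo V]. It determines the older
    side as a component, hence the younger side, and the edges are the induced ones. *)
Lemma dec_uniq V F F1 F2 V1 V2 x G1 G2 W1 W2 y :
  dec V F F1 F2 V1 V2 x -> dec V F G1 G2 W1 W2 y -> F1 = G1 /\ F2 = G2.
Proof.
move=> d d'; have [c _ _ _] := d; have [c' _ _ _] := d'.
have xE : x = y.
  have xW := dec_min_nbr d' (subsetP (dec_sub1 d) _ (dec_mx d)) (cut_xM c).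
  have yV := dec_min_nbr d (subsetP (dec_sub1 d') _ (dec_mx d')) (cut_xM c').
  by apply/val_inj/eqP; rewrite eqn_leq (cut_le c' xW) (cut_le c yV).
subst y; have VE1 : V1 = W1.
  apply/setP => v; case: (eqVneq v x) => [->|vx]; first by rewrite (cut_x1 c) (cut_x1 c').
  apply/idP/idP => v1.
    exact: dec_conn d' (leqnn _) (dec_conn_side d v1 vx).
  exact: dec_conn d (leqnn _) (dec_conn_side d' v1 vx).
subst W1; have VE2 : V2 = W2 by rewrite (cut_V2 c) (cut_V2 c').
subst W2; split; apply/setP => e.
  by rewrite (dec_mem1 e d) (dec_mem1 e d').
by rewrite (dec_mem2 e d) (dec_mem2 e d').
Qed.

(** Uniqueness identifies the pair chosen by [epsilon]. *)
Lemma decompE V F F1 F2 V1 V2 x : dec V F F1 F2 V1 V2 x -> decomp V F = (F1, F2).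
Proof.
move=> d; have V3 := dec_gt2 d; have := decompP V3 (dec_facet d).
case: (decomp V F) => G1 G2 /= /(decomp_dec (ltnW V3)) d'.
by have [-> ->] := dec_uniq d d'.
Qed.

Lemma dec_VE1 V F F1 F2 V1 V2 x : dec V F F1 F2 V1 V2 x -> VE F1 = V1.
Proof. by case=> c f1 _ _; apply: facet_VE f1; apply: cut_gt1 c. Qed.

Lemma dec_VE2 V F F1 F2 V1 V2 x : dec V F F1 F2 V1 V2 x -> VE F2 = V2.
Proof. by case=> c _ f2 _; apply: facet_VE f2; apply: cut_gt2 c. Qed.

(** * Unfolding trees and shelling sets along a decomposition *)

(** Both sides have fewer vertices than [V], so the fuel suffices at every level; this lets the
    recursion restart with the size of each side as fuel. *)
Lemma dtree_fuelE k l V F : 1 < #|V| -> facet V F -> #|V| <= k -> #|V| <= l ->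
  dtree_fuel k V F = dtree_fuel l V F.
Proof.
elim: k l V F => [|k IH] [|l] V F V1 fF Vk Vl; try lia.
rewrite /=; case: leqP => // V3.
have [F1 [F2 [W1 [W2 [x d]]]]] := facet_dec V3 fF.
rewrite (decompE d) /= (dec_VE1 d) (dec_VE2 d); have [c f1 f2 _] := d.
have := cut_card c; have c1 := cut_gt1 c; have c2 := cut_gt2 c => cc.
by rewrite (IH l W1) ?(IH l W2) //; lia.
Qed.

Lemma decomp_treeE V F F1 F2 V1 V2 x : dec V F F1 F2 V1 V2 x ->
  decomp_tree V F = DNode V (decomp_tree V1 F1) (decomp_tree V2 F2).
Proof.
move=> d; have V3 := dec_gt2 d; have [c f1 f2 _] := d.
have := cut_card c; have c1 := cut_gt1 c; have c2 := cut_gt2 c => cc.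
rewrite {1}/decomp_tree; case E: #|V| => [|k]; first by rewrite E in V3.
rewrite /= E; rewrite E in V3 cc; rewrite leqNgt V3 /=.
rewrite (decompE d) /= (dec_VE1 d) (dec_VE2 d) /decomp_tree.
by rewrite (@dtree_fuelE k #|V1|) ?(@dtree_fuelE k #|V2|) //; lia.
Qed.

Lemma decomp_tree2 V F : #|V| <= 2 -> decomp_tree V F = DLeaf V.
Proof. by rewrite /decomp_tree => V2; case E: #|V| => [|k] //=; rewrite V2. Qed.

Lemma droot_decomp_tree V F : droot (decomp_tree V F) = V.
Proof. by rewrite /decomp_tree; case: #|V| => [|k] //=; case: ifP. Qed.

Lemma sigma_fuelE k l V F : 1 < #|V| -> facet V F -> #|V| <= k -> #|V| <= l ->
  sigma_fuel k V F = sigma_fuel l V F.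
Proof.
elim: k l V F => [|k IH] [|l] V F V1 fF Vk Vl; try lia.
rewrite /=; case: leqP => // V3.
have [F1 [F2 [W1 [W2 [x d]]]]] := facet_dec (ltnW V3) fF.
rewrite (decompE d) /= (dec_VE1 d) (dec_VE2 d); have [c f1 f2 _] := d.
have := cut_card c; have c1 := cut_gt1 c; have c2 := cut_gt2 c => cc.
by rewrite (IH l W2) //; lia.
Qed.

Definition top_edges (s : seq {set T}) : {set {set T}} :=
  [set top_edge X | X in [pred X | X \in s]].

Lemma top_edgesP (s : seq {set T}) e :
  reflect (exists2 X, X \in s & e = top_edge X) (e \in top_edges s).
Proof. exact: imsetP. Qed.

Lemma sigmaE V F F1 F2 V1 V2 x : dec V F F1 F2 V1 V2 x -> 3 < #|V| ->
  sigma V F = if V1 == [set mino V; min2o V] then sigma V2 F2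
              else sigma V2 F2 :|: top_edges (Lnodes (decomp_tree V1 F1)).
Proof.
move=> d V3; have [c f1 f2 _] := d.
have := cut_card c; have c1 := cut_gt1 c; have c2 := cut_gt2 c => cc.
rewrite {1}/sigma; case E: #|V| => [|k]; first by rewrite E in V3.
rewrite /= E; rewrite E in V3 cc; rewrite leqNgt V3 /=.
rewrite (decompE d) /= (dec_VE1 d) (dec_VE2 d) /sigma.
by rewrite (@sigma_fuelE k #|V2|) //; lia.
Qed.

Lemma sigma3 V F : #|V| <= 3 -> sigma V F = set0.
Proof. by rewrite /sigma => V2; case E: #|V| => [|k] //=; rewrite V2. Qed.

Lemma Lnodes_decomp_tree V F F1 F2 V1 V2 x : dec V F F1 F2 V1 V2 x ->
  Lnodes (decomp_tree V F) =
  V :: Lnodes (decomp_tree V1 F1) ++ firstborn (decomp_tree V2 F2).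
Proof. by move=> d; rewrite /Lnodes (decomp_treeE d). Qed.

Lemma Lnodes_sub V F : 1 < #|V| -> facet V F -> top_edges (Lnodes (decomp_tree V F)) \subset F.
Proof.
move: V F; apply: facet_ind => [V F V2 fF|V F F1 F2 V1 V2 x V3 fF d IH1 IH2].
  apply/subsetP => e /top_edgesP[X + ->]; rewrite decomp_tree2 ?V2 // inE => /eqP->.
  by apply: facet_top; rewrite ?V2.
apply/subsetP => e /top_edgesP[X + ->]; rewrite (Lnodes_decomp_tree d) inE mem_cat.
case/or3P => [/eqP->|X1|X2].
- by apply: facet_top => //; apply: ltnW.
- by apply/(subsetP (dec_sub1 d))/(subsetP IH1)/top_edgesP; exists X.
- apply/(subsetP (dec_sub2 d))/(subsetP IH2)/top_edgesP; exists X => //.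
  by rewrite inE X2 orbT.
Qed.

(* The edges of the nodes in L(T(F)) form a spanning tree of V in which
   [maxo V] is a leaf. *)
Lemma conn_min_Lnodes V F : 1 < #|V| -> facet V F ->
  forall a, a \in V -> a != maxo V ->
  conn (top_edges (Lnodes (decomp_tree V F))) (maxo V) a (mino V).
Proof.
move: V F; apply: facet_ind => [V F V2 fF a aV aM|V F F1 F2 V1 V2 x V3 fF d IH1 IH2 a aV aM].
  by rewrite (eqP (min_of_two V2 aV aM)); apply: connect0.
have [c f1 f2 _] := d; have ltM := cut_lt_M c.
rewrite (cut_max1 c) (cut_min1 c) in IH1; rewrite (cut_max2 c) in IH2.
rewrite (Lnodes_decomp_tree d); set L := top_edges _.
have LP X : X \in V :: Lnodes (decomp_tree V1 F1) ++ firstborn (decomp_tree V2 F2) -> top_edge X \in L.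
  by move=> XL; apply/top_edgesP; exists X.
have sub1 : top_edges (Lnodes (decomp_tree V1 F1)) \subset L.
  by apply/subsetP => e /top_edgesP[X XL ->]; apply: LP; rewrite inE mem_cat XL orbT.
have IH2' b : b \in V2 -> b != maxo V -> conn L (maxo V) b (mino V2).
  move=> b2 bM; apply: conn_sub (IH2 _ b2 bM) (leqnn _) _ => s t sM tM /top_edgesP[X].
  rewrite inE => /predU1P[->|X2 ->]; last by apply: LP; rewrite inE mem_cat X2 !orbT.
  rewrite droot_decomp_tree (cut_top2 c).
  by case/set2_eqP => [[_ E]|[E _]]; rewrite E ltnn in sM tM.
have xm : conn L (maxo V) x (mino V).
  apply: conn_edge => //; last by apply: ltn_trans ltM; apply: cut_lt_m c.
  rewrite setUC -(cut_top1 c); apply: LP.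
  by rewrite inE mem_cat inE droot_decomp_tree eqxx orbT.
case: (cut_either c aV) => [a1|a2].
  case: (eqVneq a x) => [->//|ax].
  exact: connS (IH1 _ a1 ax) (ltnW ltM) sub1.
apply: conn_trans (IH2' _ a2 aM) _; apply: conn_trans xm.
by rewrite conn_sym; apply: IH2' (cut_x2 c) (cut_xM c).
Qed.

(** * The orders on vertex sets, traversals and facets *)

Lemma lexgt_irr (s : seq {set T}) : lexgt s s = false.
Proof. by elim: s => //= x s ->; rewrite eqxx. Qed.

Lemma lexgt_cat (s1 s2 t1 t2 : seq {set T}) : size s1 = size t1 ->
  lexgt (s1 ++ s2) (t1 ++ t2) = if s1 == t1 then lexgt s2 t2 else lexgt s1 t1.
Proof.
elim: s1 t1 => [|X s IH] [|Y t] //= [/IH->].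
by rewrite eqseq_cons; case: eqP.
Qed.

Lemma symdiff_ex X Y : X != Y -> exists a, a \in (X :\: Y) :|: (Y :\: X).
Proof.
move=> XY; apply/set0Pn; apply: contraNneq XY => /setP E; apply/eqP/setP => a.
by have := E a; rewrite !inE; case: (a \in X); case: (a \in Y).
Qed.

Lemma setgt_total X Y : X != Y -> setgt X Y || setgt Y X.
Proof.
move=> XY; have [a /mino_in] := symdiff_ex XY.
rewrite /setgt (eq_sym Y) XY [(Y :\: X) :|: _]setUC.
case: ltngtP => //= _; rewrite !inE.
by case: (_ \in X); case: (_ \in Y).
Qed.

Lemma setgt_sub X Y : X \subset Y -> setgt X Y = false.
Proof.
move=> XY; rewrite /setgt ltnNge subset_leq_card //=.
case: eqP => //= XYc; suff -> : X = Y by rewrite eqxx.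
by apply/eqP; rewrite eqEcard XY XYc leqnn.
Qed.

Lemma lexgt_total (s t : seq {set T}) : size s = size t -> s != t -> lexgt s t || lexgt t s.
Proof.
elim: s t => [|X s IH] [|Y t] //= [st]; rewrite eqseq_cons (eq_sym Y).
by case: eqP => [_|/eqP XY _] /=; [apply: IH|apply: setgt_total].
Qed.

(** The length depends only on [#|V|], so traversals over the same cut split at the same
    position. *)
Lemma size_traversal V F : 1 < #|V| -> facet V F ->
  size (traversal (decomp_tree V F)) = (#|V|.*2 - 3)%N.
Proof.
move: V F; apply: facet_ind => [V F V2 fF|V F F1 F2 V1 V2 x V3 fF d IH1 IH2].
  by rewrite decomp_tree2 V2.
rewrite (decomp_treeE d) /= size_cat IH1 IH2; have [c _ _ _] := d.
have := cut_card c; have := cut_gt1 c; have := cut_gt2 c => c1 c2 cc.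
by rewrite -!muln2; move: c1 c2 cc V3; move: #|V1| #|V2| #|V| => *; lia.
Qed.

Lemma head_traversal (t : @dtree n) : exists s, traversal t = droot t :: s.
Proof. by case: t => [X|X l r] /=; [exists [::]|exists (traversal l ++ traversal r)]. Qed.

(** The second entry of the traversal is the older side, which determines the cut; the known lengths
    then separate the two subtrees. *)
Lemma traversal_inj V F : 1 < #|V| -> facet V F -> forall G, facet V G ->
  traversal (decomp_tree V F) = traversal (decomp_tree V G) -> F = G.
Proof.
move: V F; apply: facet_ind => [V F V2 fF G fG _|V F F1 F2 V1 V2 x V3 fF d IH1 IH2 G fG].
  by rewrite (facet_small _ fF) ?V2 // (facet_small _ fG) ?V2.
have [G1 [G2 [W1 [W2 [y d']]]]] := facet_dec V3 fG.
have [c f1 f2 FE] := d; have [c' g1 g2 GE] := d'.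
rewrite (decomp_treeE d) (decomp_treeE d') /= => -[E].
have EV1 : V1 = W1.
  move: E; have [s ->] := head_traversal (decomp_tree V1 F1).
  by have [t ->] := head_traversal (decomp_tree W1 G1); rewrite !droot_decomp_tree => -[].
subst W1; have xy : x = y by rewrite -(cut_max1 c) (cut_max1 c').
subst y; have EV2 : V2 = W2 by rewrite (cut_V2 c) (cut_V2 c').
subst W2; move/eqP: E; rewrite eqseq_cat; last by rewrite !size_traversal // (cut_gt1 c).
by case/andP => /eqP/(IH1 _ g1) E1 /eqP/(IH2 _ g2) E2; rewrite FE GE E1 E2.
Qed.

Lemma facgt_irr V F : facgt V F F = false.
Proof. exact: lexgt_irr. Qed.

Lemma facgt_total V F G : 1 < #|V| -> facet V F -> facet V G -> F <> G ->
  facgt V F G \/ facgt V G F.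
Proof.
move=> V1 fF fG FG; apply/orP/lexgt_total; first by rewrite !size_traversal.
by apply/eqP => /(traversal_inj V1 fF fG).
Qed.

(** The roots agree, the next entries are the older sides, and equal older sides give blocks of
    equal length; by injectivity, equal blocks mean equal facets. *)
Lemma facgtE V F F1 F2 V1 V2 x G G1 G2 W1 W2 y :
  dec V F F1 F2 V1 V2 x -> dec V G G1 G2 W1 W2 y ->
  facgt V F G = if V1 == W1 then (if F1 == G1 then facgt V2 F2 G2 else facgt V1 F1 G1)
                else setgt V1 W1.
Proof.
move=> d d'; have [c f1 _ _] := d; have [c' g1 _ _] := d'.
rewrite /facgt (decomp_treeE d) (decomp_treeE d') /= eqxx.
case: eqP => [E|VW]; last first.
  have [s ->] := head_traversal (decomp_tree V1 F1); have [t ->] := head_traversal (decomp_tree W1 G1).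
  by rewrite !droot_decomp_tree /=; case: eqP.
subst W1; have xy : x = y by rewrite -(cut_max1 c) (cut_max1 c').
subst y; have EV2 : V2 = W2 by rewrite (cut_V2 c) (cut_V2 c').
subst W2; have V1gt := cut_gt1 c; rewrite lexgt_cat ?size_traversal //.
case: eqP => [/(traversal_inj V1gt f1 g1)->|ne]; first by rewrite eqxx.
by case: eqP => [E|//]; rewrite E in ne.
Qed.

(** * Condition (SH1) *)

(** The edge from [mino V] to [x] puts [x] in [W1], hence [x <= y]. The listed edges then connect
    the rest of [V1] to [mino V] below [x], and such routes cannot leave [W1]. *)
Lemma dec_side_sub V F F1 F2 V1 V2 x G G1 G2 W1 W2 y :
  dec V F F1 F2 V1 V2 x -> dec V G G1 G2 W1 W2 y ->
  top_edges (Lnodes (decomp_tree V1 F1)) \subset G -> V1 \subset W1.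
Proof.
move=> d d' sub; have [c f1 _ _] := d; have [c' _ _ _] := d'.
have mx : [set mino V; x] \in G.
  apply: (subsetP sub); rewrite -(cut_top1 c); apply/top_edgesP; exists V1 => //.
  by rewrite inE droot_decomp_tree eqxx.
have xW := dec_min_nbr d' mx (cut_xM c).
apply/subsetP => v v1; case: (eqVneq v x) => [->//|vx].
apply: (dec_conn d' (cut_le c' xW)); rewrite conn_sym.
have := conn_min_Lnodes (cut_gt1 c) f1 v1; rewrite (cut_max1 c) (cut_min1 c) => /(_ vx) cv.
exact: connS cv (leqnn _) sub.
Qed.

Lemma dec_sub2_of V F1 F2 V1 V2 x (S : {set {set T}}) G2 G : dec V G F1 G2 V1 V2 x ->
  facet V2 F2 -> S \subset F2 -> S \subset G -> S \subset G2.
Proof.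
move=> d f2 SF SG; apply/subsetP => e eS; rewrite (dec_mem2 e d) (subsetP SG) //=.
by have := subsetP (facet_edges f2) _ (subsetP SF _ eS); rewrite inE => /andP[].
Qed.

(** Used in (SH1) for facets with the same older vertex set. At each level the older side of [G]
    contains that of [F], so it is not smaller; if the two sides agree, recursion applies. *)
Lemma facgt_Lnodes V F : 1 < #|V| -> facet V F -> forall G, facet V G ->
  top_edges (Lnodes (decomp_tree V F)) \subset G -> facgt V F G = false.
Proof.
move: V F; apply: facet_ind => [V F V2 fF G fG _|V F F1 F2 V1 V2 x V3 fF d IH1 IH2 G fG sub].
  by rewrite (facet_small _ fF) ?V2 // (facet_small _ fG) ?V2 // facgt_irr.
have [G1 [G2 [W1 [W2 [y d']]]]] := facet_dec V3 fG.
have [c f1 f2 _] := d; have [c' g1 g2 _] := d'.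
have sub1 : top_edges (Lnodes (decomp_tree V1 F1)) \subset G.
  apply/subsetP => e /top_edgesP[X XL ->]; apply: (subsetP sub); apply/top_edgesP.
  by exists X => //; rewrite (Lnodes_decomp_tree d) inE mem_cat XL orbT.
rewrite (facgtE d d'); case: eqP => [E|_]; last by apply/setgt_sub/(dec_side_sub d d').
subst W1; have xy : x = y by rewrite -(cut_max1 c) (cut_max1 c').
subst y; have EV2 : V2 = W2 by rewrite (cut_V2 c) (cut_V2 c').
subst W2; case: eqP => _.
  (* The root of the younger tree is absent from the list for [V], but every facet on [V2] contains
     its top edge. *)
  apply: IH2 => //; apply/subsetP => e /top_edgesP[X].
  rewrite inE droot_decomp_tree => /predU1P[-> ->|X2 ->]; first by apply: facet_top; rewrite // (cut_gt2 c).
  rewrite (dec_mem2 _ d'); apply/andP; split.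
    apply: (subsetP sub); apply/top_edgesP; exists X => //.
    by rewrite (Lnodes_decomp_tree d) inE mem_cat X2 !orbT.
  have : top_edge X \in F2.
    apply: (subsetP (Lnodes_sub (cut_gt2 c) f2)); apply/top_edgesP; exists X => //.
    by rewrite inE X2 orbT.
  by move/(subsetP (facet_edges f2)); rewrite inE => /andP[].
apply: IH1 => //; apply/subsetP => e eL; rewrite (dec_mem1 _ d') (subsetP sub1) //=.
have := subsetP (facet_edges f1) _ (subsetP (Lnodes_sub (cut_gt1 c) f1) _ eL).
by rewrite inE => /andP[].
Qed.

Lemma sigma_sub V F : 1 < #|V| -> facet V F -> sigma V F \subset F.
Proof.
move: V F; apply: facet_ind => [V F V2 fF|V F F1 F2 V1 V2 x V3 fF d IH1 IH2].
  by rewrite sigma3 ?V2 ?sub0set.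
case: (leqP #|V| 3) => [V3'|V4]; first by rewrite sigma3 ?sub0set.
have sub2 := subset_trans IH2 (dec_sub2 d); rewrite (sigmaE d V4); case: ifP => // _.
have [c f1 _ _] := d; rewrite subUset sub2 /=.
exact: subset_trans (Lnodes_sub (cut_gt1 c) f1) (dec_sub1 d).
Qed.

Lemma cut_min2 V V1 V2 x : cut V V1 V2 x ->
  [/\ min2o V \in V, mino V < min2o V & forall v, v \in V -> v != mino V -> min2o V <= v].
Proof.
move=> c; have xV : x \in V :\ mino V.
  by rewrite !inE eq_sym (cut_mx c) (subsetP (cut_sub1 c)) // (cut_x1 c).
have := mino_in xV; rewrite -/(min2o V) !inE => /andP[ne mV]; split=> //.
  have := mino_le mV; rewrite leq_eqVlt => /predU1P[/val_inj E|//].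
  by rewrite -E eqxx in ne.
by move=> v vV vm; apply: mino_le; rewrite !inE vm.
Qed.

(** An older side without [min2o V] has at least two elements; if it has exactly two, it first
    differs from the pair at [min2o V], which lies in the pair. *)
Lemma setgt_min2 V W1 W2 y : cut V W1 W2 y -> setgt [set mino V; min2o V] W1 = false.
Proof.
move=> c; have [m2V lt2 le2] := cut_min2 c.
case/boolP: (min2o V \in W1) => m2.
  by apply: setgt_sub; rewrite subUset !sub1set (cut_m c) m2.
rewrite /setgt cards2 neq_ltn_ord lt2 ltnNge (cut_gt1 c) /=.
apply/negP => /and3P[_ _]; set S := _ :|: _ => kW.
have m2S : min2o V \in S by rewrite !inE m2 eqxx orbT.
have kS := mino_in m2S; have := mino_le m2S.
have km : mino S != mino V.
  by apply: contraTneq kS => ->; rewrite !inE eqxx (cut_m c).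
have := le2 _ (subsetP (cut_sub1 c) _ kW) km => l1 l2.
have E : mino S = min2o V by apply/val_inj/eqP; rewrite eqn_leq l1 l2.
by rewrite E (negPf m2) in kW.
Qed.

(** If the older side is the pair of the two smallest vertices, then [G] has the same older facet.
    Otherwise, if [G] contains the listed edges, [dec_side_sub] and [facgt_Lnodes] force equal older
    facets. Either way the comparison moves to the younger side. *)
Lemma sigma_not_sub V F : 1 < #|V| -> facet V F -> forall G, facet V G ->
  facgt V F G -> ~~ (sigma V F \subset G).
Proof.
move: V F; apply: facet_ind => [V F V2 fF G fG|V F F1 F2 V1 V2 x V3 fF d IH1 IH2 G fG].
  by rewrite (facet_small _ fF) ?V2 // (facet_small _ fG) ?V2 // facgt_irr.
case: (leqP #|V| 3) => [V3'|V4].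
  by rewrite (facet_small V3' fF) (facet_small V3' fG) facgt_irr.
have [G1 [G2 [W1 [W2 [y d']]]]] := facet_dec V3 fG.
have [c f1 f2 _] := d; have [c' g1 g2 _] := d'.
have step2 : V1 = W1 -> F1 = G1 -> facgt V2 F2 G2 -> ~~ (sigma V2 F2 \subset G).
  move=> E E1; subst W1 G1; have xy : x = y by rewrite -(cut_max1 c) (cut_max1 c').
  subst y; have EV2 : V2 = W2 by rewrite (cut_V2 c) (cut_V2 c').
  subst W2 => /(IH2 _ g2); apply: contraNN => sub.
  by apply: (dec_sub2_of d' f2 _ sub); apply: sigma_sub; rewrite // (cut_gt2 c).
rewrite (facgtE d d') (sigmaE d V4).
case: (eqVneq V1 [set mino V; min2o V]) => [E1|_].
  case: (eqVneq V1 W1) => [E|_]; last by rewrite E1 (setgt_min2 c').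
  subst W1; suff E : F1 = G1 by rewrite E eqxx; apply: step2.
  have V13 : #|V1| <= 3 by rewrite E1 cards2; case: (_ != _).
  by rewrite (facet_small V13 f1) (facet_small V13 g1).
rewrite subUset negb_and => gt; case/boolP: (top_edges _ \subset G) => [sub|_]; last by rewrite orbT.
rewrite orbF; have VW := dec_side_sub d d' sub.
move: gt; case: (eqVneq V1 W1) => [E|_]; last by rewrite setgt_sub.
case: (eqVneq F1 G1) => [E1|_]; first exact: step2.
subst W1; rewrite facgt_Lnodes ?(cut_gt1 c) //.
apply/subsetP => e eL; rewrite (dec_mem1 _ d') (subsetP sub) //=.
have := subsetP (facet_edges f1) _ (subsetP (Lnodes_sub (cut_gt1 c) f1) _ eL).
by rewrite inE => /andP[].
Qed.

(** * Condition (SH2) *)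

(** A weak form of (SH2): for [e] in [F], maximality of [F] turns the inclusion into the exact
    difference. *)
Definition lower V F e := exists G, [/\ facet V G, facgt V F G & F :\ e \subset G].

Lemma lower1 V F F1 F2 V1 V2 x e :
  dec V F F1 F2 V1 V2 x -> lower V1 F1 e -> lower V F e.
Proof.
move=> d [G1 [g1 gt1 sub]]; have [c f1 f2 FE] := d.
have d' : dec V (G1 :|: F2 :|: [set top_edge V]) G1 F2 V1 V2 x by [].
exists (G1 :|: F2 :|: [set top_edge V]); split; first exact: dec_facet d'.
  by rewrite (facgtE d d') eqxx; case: eqP => // E; rewrite E facgt_irr in gt1.
rewrite FE !setDUl; apply: setUSS; last exact: subsetDl.
by apply: setUSS sub _; apply: subsetDl.
Qed.

Lemma lower2 V F F1 F2 V1 V2 x e :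
  dec V F F1 F2 V1 V2 x -> lower V2 F2 e -> lower V F e.
Proof.
move=> d [G2 [g2 gt2 sub]]; have [c f1 f2 FE] := d.
have d' : dec V (F1 :|: G2 :|: [set top_edge V]) F1 G2 V1 V2 x by [].
exists (F1 :|: G2 :|: [set top_edge V]); split; first exact: dec_facet d'.
  by rewrite (facgtE d d') !eqxx.
rewrite FE !setDUl; apply: setUSS; last exact: subsetDl.
by apply: setUSS sub; apply: subsetDl.
Qed.

(** Deleting [e] may allow a cut with a smaller older side; [face_cut] extends what remains to a
    facet decomposed along that cut. *)
Lemma lower_cut V F F1 F2 V1 V2 x e C y :
  dec V F F1 F2 V1 V2 x -> C \subset V -> y \in V -> y != maxo V -> mino V \in C ->
  (forall u, u \in C -> u < y) -> setgt V1 (y |: C) ->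
  (forall u w, u \in C -> w \notin C -> [set u; w] \in F :\ e ->
     w = y \/ (u = mino V /\ w = maxo V)) ->
  lower V F e.
Proof.
move=> d CV yV yM mC lty gt closed; have fF := dec_facet d.
have V2gt := ltnW (dec_gt2 d).
have c := cut_of_set V2gt CV yV yM mC lty.
have [G1 [G2 [g1 g2 sub]]] := face_cut V2gt (faceS (facet_face fF) (subsetDl _ _)) c closed.
have d' : dec V (G1 :|: G2 :|: [set top_edge V]) G1 G2 (y |: C) (V :\: C) y by [].
exists (G1 :|: G2 :|: [set top_edge V]); split=> //; first exact: dec_facet d'.
rewrite (facgtE d d'); case: eqP => // E.
by rewrite -E setgt_sub in gt.
Qed.

Lemma setgt_card X Y : #|Y| < #|X| -> setgt X Y.
Proof. by rewrite /setgt => ->. Qed.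

(** The older side [V11] of [V1] becomes the older side of [V]: apart from the top edge of [V], the
    only edge leaving it away from [x'] is the deleted one. *)
Lemma lower_root V F F1 F2 V1 V2 x :
  dec V F F1 F2 V1 V2 x -> 2 < #|V1| -> lower V F (top_edge V1).
Proof.
move=> d V13; have [c f1 f2 _] := d.
have [F11 [F12 [V11 [V12 [x' d1]]]]] := facet_dec V13 f1.
have [c1 f11 f12 _] := d1.
have V11c : x' |: (V11 :\ x') = V11 by rewrite setD1K // (cut_x1 c1).
have x'1 := subsetP (cut_sub1 c1) _ (cut_x1 c1).
have ltx : x' < x by rewrite -(cut_max1 c) (cut_lt_M c1).
apply: (lower_cut (C := V11 :\ x') (y := x') d).
- by apply: subset_trans (subsetDl _ _) (subset_trans (cut_sub1 c1) (cut_sub1 c)).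
- exact: subsetP (cut_sub1 c) _ x'1.
- by apply: contraTneq x'1 => ->; apply: cut_M1 c.
- by rewrite !inE -(cut_min1 c) (cut_mx c1) (cut_m c1).
- by move=> u /setD1P[ux u1]; exact: (cut_lt c1 u1 ux).
- rewrite V11c; apply: setgt_card.
  by have := cut_card c1; have := cut_gt2 c1; move: #|V1| #|V11| #|V12| => *; lia.
- move=> u w /setD1P[ux u11] wC /setD1P[uwe uw].
  have u1 := subsetP (cut_sub1 c1) _ u11; have ltu := cut_lt c1 u11 ux.
  have ux' : u != x by rewrite neq_ltn_ord (ltn_trans ltu ltx).
  case: (dec_edge d u1 ux' uw) => [uw1|]; last by right.
  case: (dec_edge d1 u11 ux uw1) => [/(edge_in (facet_edges f11))[_ w1 _]|[E E']].
    by left; apply/eqP; move: wC; rewrite !inE w1 andbT negbK.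
  by rewrite E E' eqxx in uwe.
Qed.

(* Removing e disconnects the vertices of V other than [maxo V]. *)
Definition splits V F e := exists C, [/\ C \subset V, maxo V \notin C, mino V \in C,
  exists v, [/\ v \in V, v != maxo V & v \notin C] &
  forall u w, u \in C -> w \notin C -> w != maxo V -> [set u; w] \notin F :\ e].

(** The vertex [x] is kept as cut vertex, with the smaller older side [x |: C]: edges of [F1] other
    than [e] that leave [C] end in [x]. *)
Lemma lower_splits V F F1 F2 V1 V2 x e :
  dec V F F1 F2 V1 V2 x -> splits V1 F1 e -> lower V F e.
Proof.
move=> d [C [CV xC mC [v [v1 vx vC]] closed]]; have [c f1 f2 _] := d.
rewrite (cut_max1 c) in xC vx closed; rewrite (cut_min1 c) in mC.
have neC u : u \in C -> u != x by apply: contraTneq => ->.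
have xV := subsetP (cut_sub1 c) _ (cut_x1 c).
apply: (lower_cut (C := C) (y := x) d) => //.
- exact: subset_trans CV (cut_sub1 c).
- exact: cut_xM c.
- by move=> u uC; exact: (cut_lt c (subsetP CV _ uC) (neC _ uC)).
- apply/setgt_card/proper_card/properP; split; first by rewrite subUset sub1set (cut_x1 c).
  by exists v => //; rewrite !inE negb_or vx.
- move=> u w uC wC /setD1P[uwe uw].
  case: (dec_edge d (subsetP CV _ uC) (neC _ uC) uw) => [uw1|]; last by right.
  left; apply/eqP/negPn/negP => wx; have := closed _ _ uC wC wx.
  by rewrite !inE uwe uw1.
Qed.

(** Nodes of the older tree are settled by [lower1] or [lower_splits], and [V1] itself by
    [lower_root] unless it has two elements. A splitting of the younger side extends to [V]. *)
Lemma lower_or_splits V F : 1 < #|V| -> facet V F ->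
  forall X, X \in firstborn (decomp_tree V F) -> lower V F (top_edge X) \/ splits V F (top_edge X).
Proof.
move: V F; apply: facet_ind => [V F V2 fF X|V F F1 F2 V1 V2 x V3 fF d IH1 IH2 X].
  by rewrite decomp_tree2 ?V2.
have [c f1 f2 FE] := d; rewrite (decomp_treeE d) /= inE mem_cat droot_decomp_tree.
have edgeM u w : [set u; w] \in F -> u != maxo V -> w != maxo V ->
    [set u; w] \in F1 \/ [set u; w] \in F2.
  rewrite FE => /setUP[/setUP[]|/set1P/set2_eqP]; [by left|by right|].
  by case=> [[_ ->]|[-> _]]; rewrite eqxx.
have m1M : maxo V \notin V1 := cut_M1 c.
case/or3P => [/eqP->|/(IH1 X)[/(lower1 d)|/(lower_splits d)]|/(IH2 X)[/(lower2 d)|]]; try by left.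
  case: (ltnP 2 #|V1|) => V13; first by left; apply: lower_root d V13.
  have VE := cut_two c V13.
  (* Here [x] is the only neighbour of [mino V] besides [maxo V], so the deletion isolates
     [mino V]. *)
  right; exists [set mino V]; split.
  - by rewrite sub1set (subsetP (cut_sub1 c)) // (cut_m c).
  - by apply: contraTN (mino_lt_maxo (ltnW V3)) => /set1P->; rewrite ltnn.
  - exact: set11.
  - exists x; split; first exact: subsetP (cut_sub1 c) _ (cut_x1 c).
      exact: cut_xM c.
    by rewrite inE eq_sym (cut_mx c).
  move=> u w /set1P-> wm wM; apply/negP => /setD1P[ne mw].
  have := dec_min_nbr d mw wM; rewrite -VE !inE; rewrite inE in wm; rewrite (negPf wm) /=.
  by move/eqP => E; rewrite E -(cut_top1 c) eqxx in ne.
move=> [C [CV MC mC [v [v2 vM vC]] closed]]; right.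
rewrite (cut_max2 c) in MC vM closed.
have splitC (u w : T) : [set u; w] \in F2 :\ top_edge X -> w != maxo V -> u != maxo V ->
    (u \in C) = (w \in C).
  move=> uw wM uM; apply/idP/idP => inC; apply/negPn/negP => outC.
    by have := closed _ _ inC outC wM; rewrite uw.
  by have := closed _ _ inC outC uM; rewrite setUC uw.
have F2V u w : [set u; w] \in F2 -> u \in V2 /\ w \in V2.
  by case/(edge_in (facet_edges f2)).
have F1V u w : [set u; w] \in F1 -> u \in V1 /\ w \in V1.
  by case/(edge_in (facet_edges f1)).
(* [V1] joins the part of [V2] that contains [x]: either [C] or its complement without [maxo V]. *)
case/boolP: (x \in C) => xC.
  exists (V1 :|: C); split.
  - by rewrite subUset (cut_sub1 c) (subset_trans CV (cut_sub2 c)).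
  - by rewrite inE negb_or m1M.
  - by rewrite inE (cut_m c).
  - exists v; split=> //; first exact: subsetP (cut_sub2 c) _ v2.
    by rewrite inE negb_or vC andbT; apply: contraNN vC => v1; rewrite (cut_both c v1 v2).
  move=> u w uC; rewrite inE negb_or => /andP[w1 wC] wM; apply/negP => /setD1P[ne uw].
  have uM : u != maxo V.
    by apply: contraTneq uC => ->; rewrite inE negb_or m1M.
  case: (edgeM _ _ uw uM wM) => [/F1V[_]|uw2]; first by rewrite (negPf w1).
  have [u2 _] := F2V _ _ uw2; case/negP: wC.
  rewrite -(splitC u) //; last by rewrite !inE ne.
  by case/setUP: uC => // u1; rewrite (cut_both c u1 u2).
exists (V1 :|: ((V2 :\ maxo V) :\: C)); split.
- rewrite subUset (cut_sub1 c); apply: subset_trans (subsetDl _ _) _.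
  by apply: subset_trans (subsetDl _ _) (cut_sub2 c).
- by rewrite !inE negb_or m1M eqxx andbF.
- by rewrite inE (cut_m c).
(* In the second case [C] is the part left out, so [mino V2] is the separated vertex. *)
- have m2 := subsetP CV _ mC; exists (mino V2); split.
  + exact: subsetP (cut_sub2 c) _ m2.
  + by apply: contraTneq mC => ->.
  + rewrite !inE mC orbF; apply: contraNN xC => m1.
    by rewrite -(cut_both c m1 m2).
move=> u w uC; rewrite in_setU negb_or => /andP[w1 wC] wM; apply/negP => /setD1P[ne uw].
have uM : u != maxo V.
  by apply: contraTneq uC => ->; rewrite !inE negb_or m1M eqxx andbF.
case: (edgeM _ _ uw uM wM) => [/F1V[_]|uw2]; first by rewrite (negPf w1).
have [u2 w2] := F2V _ _ uw2.
have : u \in C.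
  rewrite (splitC u w) //; last by rewrite !inE ne.
  by move: wC; rewrite !inE wM w2 !andbT negbK.
apply/negP; case/setUP: uC => [u1|]; first by rewrite (cut_both c u1 u2).
by rewrite !inE => /andP[].
Qed.

(** Proper descendants of [V1] follow from [lower_or_splits], a splitting of [V1] being usable one
    level up. For [V1] itself, only the two-element case needs a new cut. *)
Lemma lower_Lnodes V F F1 F2 V1 V2 x X : dec V F F1 F2 V1 V2 x ->
  V1 != [set mino V; min2o V] -> X \in Lnodes (decomp_tree V1 F1) ->
  lower V F (top_edge X).
Proof.
move=> d V1ne; have [c f1 f2 _] := d; rewrite inE droot_decomp_tree.
case/predU1P => [->|X1]; last first.
  by have [/(lower1 d)|/(lower_splits d)] := lower_or_splits (cut_gt1 c) f1 X1.
case: (ltnP 2 #|V1|) => V13; first exact: lower_root d V13.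
have VE := cut_two c V13.
have [m2V lt2 le2] := cut_min2 c.
have xV := subsetP (cut_sub1 c) _ (cut_x1 c).
have lt2x : min2o V < x.
  have := le2 _ xV; rewrite eq_sym (cut_mx c) leq_eqVlt => /(_ isT) /predU1P[/val_inj E|//].
  by rewrite -VE -E eqxx in V1ne.
have ltxM := cut_lt_M c.
have m2M : min2o V != maxo V by rewrite neq_ltn_ord (ltn_trans lt2x ltxM).
have mm2 : mino V != min2o V by rewrite neq_ltn_ord lt2.
have m2x : min2o V != x by rewrite neq_ltn_ord lt2x.
(* Without its edge to [x], [mino V] can be cut off at [min2o V]; since [min2o V < x], this pair is
   smaller than [V1] in the order. *)
apply: (lower_cut (C := [set mino V]) (y := min2o V) d) => //.
- by rewrite sub1set (subsetP (cut_sub1 c)) // (cut_m c).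
- exact: set11.
- by move=> u /set1P->.
- have mV := mino_in xV; rewrite -VE /setgt !cards2 (cut_mx c) (eq_sym (min2o V)) mm2 ltnn eqxx /=.
  apply/andP; split.
    apply/eqP => /setP/(_ (min2o V)); rewrite !inE eqxx (eq_sym _ (mino V)) (negPf mm2).
    by rewrite (negPf m2x).
  rewrite (mino_eq (a := min2o V)) ?inE ?eqxx //.
    by rewrite (eq_sym _ (mino V)) (negPf mm2) (negPf m2x).
  move=> b bS; apply: le2; first by move: bS; rewrite !inE => /orP[]/andP[_ /orP[]/eqP->].
  by apply: contraTneq bS => ->; rewrite !inE eqxx !orbT.
move=> u w /set1P-> wm /setD1P[ne mw]; right; split=> //; apply/eqP/negPn/negP => wM.
have := dec_min_nbr d mw wM; rewrite -VE !inE; rewrite inE in wm; rewrite (negPf wm) /=.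
by move/eqP => E; rewrite E -(cut_top1 c) eqxx in ne.
Qed.

Lemma sigma_lower V F : 1 < #|V| -> facet V F -> forall e, e \in sigma V F -> lower V F e.
Proof.
move: V F; apply: facet_ind => [V F V2 fF e|V F F1 F2 V1 V2 x V3 fF d IH1 IH2 e].
  by rewrite sigma3 ?V2 // inE.
case: (leqP #|V| 3) => [V3'|V4]; first by rewrite sigma3 // inE.
rewrite (sigmaE d V4); case: eqVneq => [_ /IH2/(lower2 d)//|V1ne].
case/setUP => [/IH2/(lower2 d)//|/top_edgesP[X XL ->]].
exact: lower_Lnodes d V1ne XL.
Qed.

End Shelling.

Theorem theorem8p3 (n : nat) (V : {set 'I_n.+1}) :
  2 <= #|V| ->
  (* ≻_fac is a total (strict) order on the facets of Δ_V *)
  (forall F G, facet V F -> facet V G -> F <> G -> facgt V F G \/ facgt V G F) /\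
  (* (SH1) *)
  (forall F G, facet V F -> facet V G -> facgt V F G -> ~~ (sigma V F \subset G)) /\
  (* (SH2) *)
  (forall F e, facet V F -> e \in sigma V F ->
     exists G, [/\ facet V G, facgt V F G & F :\: G = [set e]]).
Proof.
move=> V2; split; first by move=> F G; apply: facgt_total.
split=> [F G fF fG gt|F e fF eS]; first exact: (sigma_not_sub V2 fF fG gt).
have [G [fG gt sub]] := sigma_lower V2 fF eS.
exists G; split=> //; have eF := subsetP (sigma_sub V2 fF) _ eS.
have eG : e \notin G.
  (* If [e] were in [G], then [G] would contain [F] and equal it by maximality, against
     irreflexivity. *)
  apply/negP => eG; have [_ mF] := fF.
  suff E : G = F by rewrite E facgt_irr in gt.
  by apply: mF; [apply: facet_face|rewrite -(setD1K eF) subUset sub1set eG].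
apply/setP => k; rewrite !inE; case: (eqVneq k e) => [->|ke]; first by rewrite eG.
by case kF: (k \in F); rewrite ?andbF //= (subsetP sub) // !inE ke.
Qed.
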